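(* Fix $\alpha\in\mathbb R$ and $\Delta>0$. Let $G\in\{\mathrm U,\mathrm{Sp},\mathrm O,\mathrm{SO(even)},\mathrm{SO(odd)}\}$ and let $K=K_{G,\pi\Delta}$ be the reproducing kernel of the Hilbert space $(\mathcal H_{\pi\Delta},\langle\cdot,\cdot\rangle_{G,\pi\Delta})$. Let $\xi_1$ be the first positive zero of the function $x\mapsto K(\alpha+x,\alpha-x)$. Then $$\mathbb A(G,\pi\Delta,\alpha)=\inf_{0\ne f\in\mathcal H_{\pi\Delta}}\frac{\int_{\mathbb R}|(x-\alpha)f(x)|^2\,W_G(x)\,\mathrm dx}{\int_{\mathbb R}|f(x)|^2\,W_G(x)\,\mathrm dx}=\xi_1^2.$$
   Context: $\mathcal H_{\pi\Delta}$ is the set of entire functions of exponential type at most $\pi\Delta$ (i.e. $\limsup_{|z|\to\infty}|z|^{-1}\log|F(z)|\le\pi\Delta$) whose restriction to $\mathbb R$ is square-integrable. Densities: $W_{\mathrm U}(x)=1$; $W_{\mathrm{Sp}}(x)=1-\frac{\sin2\pi x}{2\pi x}$; $W_{\mathrm O}(x)=1+\tfrac12\boldsymbol\delta_0(x)$; $W_{\mathrm{SO(even)}}(x)=1+\frac{\sin2\pi x}{2\pi x}$; $W_{\mathrm{SO(odd)}}(x)=1-\frac{\sin2\pi x}{2\pi x}+\boldsymbol\delta_0(x)$, with $\boldsymbol\delta_0$ the Dirac delta at $0$. The inner product is $\langle F,H\rangle_{G,\pi\Delta}=\int_{\mathbb R}F(x)\overline{H(x)}\,W_G(x)\,\mathrm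 dx$ (with the delta contributing a point-mass term at $0$); $(\mathcal H_{\pi\Delta},\langle\cdot,\cdot\rangle_{G,\pi\Delta})$ is a Hilbert space in which point evaluations are continuous. The reproducing kernel is the function $K(w,z)$ such that for each $w\in\mathbb C$, $K(w,\cdot)\in\mathcal H_{\pi\Delta}$ and $F(w)=\langle F,K(w,\cdot)\rangle_{G,\pi\Delta}$ for all $F\in\mathcal H_{\pi\Delta}$. *)

(* Defs.v *)
From HB Require Import structures.
From mathcomp Require Export all_boot all_order all_algebra.
From mathcomp Require Export complex.
From mathcomp Require Export all_classical all_reals all_analysis.

Set Implicit Arguments.
Unset Strict Implicit.
Unset Printing Implicit Defensive.

Export Order.TTheory GRing.Theory Num.Theory.
Export numFieldNormedType.Exports.

Local Open Scope classical_set_scope.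
Local Open Scope complex_scope.
Local Open Scope ring_scope.

Notation cmod := ComplexField.Normc.normc (only parsing).

Definition entire (R : realType) (F : R[i] -> R[i]) : Prop :=
  forall z : R[i], derivable (F : R[i]^o -> R[i]^o) z 1.

Definition cinfty_nbhs (R : realType) : set_system R[i] :=
  [set A | exists M : R, forall z : R[i], M < cmod z -> A z].

(* lne 0 = -oo, so that zeros of F do not contribute to the limsup. *)
Definition exp_type_le (R : realType) (tau : R) (F : R[i] -> R[i]) : Prop :=
  (limf_esup (fun z : R[i]^o => ((cmod z)^-1)%:E * lne (cmod (F z))%:E)
     (@cinfty_nbhs R) <= tau%:E)%E.

Definition sq_integrable_line (R : realType) (F : R[i] -> R[i]) : Prop :=
  (\int[@lebesgue_measure R]_(x in setT) (cmod (F x%:C) ^+ 2)%:E < +oo)%E.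

Definition PW (R : realType) (tau : R) : set (R[i] -> R[i]) :=
  [set F | [/\ entire F, exp_type_le tau F & sq_integrable_line F]].

Inductive symmetry_group := GU | GSp | GO | GSOeven | GSOodd.

(* sin (2 pi x) / (2 pi x), extended continuously at 0 *)
Definition sinc2pi (R : realType) (x : R) : R :=
  if x == 0 then 1 else sin (2 * pi * x) / (2 * pi * x).

(* W_G = W_dens G + W_mass G * delta_0 *)
Definition W_dens (R : realType) (G : symmetry_group) (x : R) : R :=
  match G with
  | GU => 1
  | GSp => 1 - sinc2pi x
  | GO => 1
  | GSOeven => 1 + sinc2pi x
  | GSOodd => 1 - sinc2pi x
  end.

Definition W_mass (R : realType) (G : symmetry_group) : R :=
  match G with
  | GU => 0
  | GSp => 0
  | GO => 2^-1
  | GSOeven => 0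
  | GSOodd => 1
  end.

Definition W_int (R : realType) (G : symmetry_group) (g : R -> R) : \bar R :=
  (\int[@lebesgue_measure R]_(x in setT) (g x * W_dens G x)%:E
   + (W_mass R G * g 0%R)%:E)%E.

Definition W_inner (R : realType) (G : symmetry_group)
    (F H : R[i] -> R[i]) : R[i] :=
  fine (W_int G (fun x : R => complex.Re (F x%:C * (H x%:C)^*%C)))
  +i* fine (W_int G (fun x : R => complex.Im (F x%:C * (H x%:C)^*%C))).

Definition is_reproducing_kernel (R : realType) (G : symmetry_group) (tau : R)
    (K : R[i] -> R[i] -> R[i]) : Prop :=
  forall w : R[i],
    PW tau (K w) /\ forall F, PW tau F -> F w = W_inner G F (K w).

(* The numerator may be +oo; the denominator is finite and positive for every
   nonzero f in PW tau. *)
Definition extremal_A (R : realType) (G : symmetry_group) (tau alpha : R)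
    : \bar R :=
  ereal_inf
    [set (W_int G (fun x : R => cmod ((x - alpha)%:C * f x%:C) ^+ 2)%R
          / W_int G (fun x : R => cmod (f x%:C) ^+ 2)%R)%E
    | f in [set f | PW tau f /\ f <> cst 0]].

Definition is_first_positive_zero (R : realType) (h : R -> R[i]) (xi : R)
    : Prop :=
  [/\ 0 < xi, h xi = 0 & forall x : R, 0 < x < xi -> h x <> 0].

(* Main.v *)
Require Import Defs.
From mathcomp Require Import ring lra measurable_realfun.

Set Implicit Arguments.
Unset Strict Implicit.
Unset Printing Implicit Defensive.

(* Put p = alpha + xi and q = alpha - xi, so that
   ||(x - alpha) f||^2 - xi^2 ||f||^2 = <(x - q) f, (x - p) f>.
   If K(p, q) = 0, then f = K_p / (z - q) lies in the space and the right-hand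
   side is <K_p, (z - p) f>, the conjugate of the value at p of (z - p) f: it
   vanishes, so xi^2 is a value of the quotient.
   Conversely let xi^2 be the infimum of the quotient. If K(p, q) were nonzero,
   the form would be coercive: split (x - q) f = h' + c K_p with h'(p) = 0 and
   h' = (z - p) g; then ||h'||^2 = <(x - q) f, (x - p) g> is bounded by
   Cauchy-Schwarz for the positive form, and c by evaluating at q, where
   (x - q) f vanishes. This contradicts the infimum, so K(p, q) = 0, without any
   appeal to completeness or compactness.
   Both directions divide by linear factors. That the quotient is entire is
   Cauchy's formula on a square; that division is bounded follows from
   sup |v|^2 <= C int |v|^2 on the line, obtained by writing v(t) as the value
   at 0 of a translate of v and pairing it with K_0. *)

Local Open Scope classical_set_scope.
Local Open Scope complex_scope.
Local Open Scope ring_scope.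

(** The obstacle is the weight. The densities for [GSp] and [GSOodd] vanish at 0, and [GO] and
    [GSOodd] carry a point mass there, so no pointwise bound compares the weighted norm with the L2
    norm. The comparison, on which bounded division rests, is drawn from the kernel itself:
    evaluation at 0 is bounded by the density part of the norm alone because the mass times K(0, 0)
    is less than 1, and translation makes this a sup bound uniform on the line. A short interval
    around 0, or around the root a, then carries at most half of the L2 mass and can be absorbed.

    The existence of a first zero is part of the conclusion. Every positive zero x makes x^2 a value
    of the quotient, so no zero lies below the square root of the infimum, which is itself a zero;
    it is positive because K(alpha, alpha) > 0.

    Both K(a, a) > 0 and the existence of a nonzero f with finite numerator need an explicit
    function: translates of the square of (e^(i c z) - 1) / z, with c = tau / 2, serve for both. *)

Section ComplexModulus.
Context {R : realType}.
Implicit Types (z w : R[i]) (x y : R).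

Local Notation Re := (@complex.Re R).
Local Notation Im := (@complex.Im R).

(** * The modulus on the complex numbers and epsilon-delta differentiation *)

Lemma normE z : `|z| = (cmod z)%:C.
Proof. by []. Qed.

Lemma cmod_ge0 z : 0 <= cmod z.
Proof. by case: z => a b; rewrite /ComplexField.Normc.normc sqrtr_ge0. Qed.

Lemma cmod_sqr z : cmod z ^+ 2 = Re z ^+ 2 + Im z ^+ 2.
Proof. by case: z => a b /=; rewrite sqr_sqrtr// addr_ge0// sqr_ge0. Qed.

Lemma cmodD z w : cmod (z + w) <= cmod z + cmod w.
Proof. exact: le_normcD. Qed.

Lemma cmodN z : cmod (- z) = cmod z.
Proof. exact: normcN. Qed.

Lemma cmodB z w : cmod (z - w) <= cmod z + cmod w.
Proof. by rewrite -(cmodN w) cmodD. Qed.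

Lemma cmod_distC z w : cmod (z - w) = cmod (w - z).
Proof. by rewrite -cmodN opprB. Qed.

Lemma cmodM z w : cmod (z * w) = cmod z * cmod w.
Proof. exact: ComplexField.Normc.normcM. Qed.

Lemma cmodV z : cmod (z^-1) = (cmod z)^-1.
Proof. exact: ComplexField.Normc.normcV. Qed.

Lemma cmod0 : cmod (0 : R[i]) = 0.
Proof. exact: ComplexField.Normc.normc0. Qed.

Lemma cmod1 : cmod (1 : R[i]) = 1.
Proof. exact: ComplexField.Normc.normc1. Qed.

Lemma cmod_eq0 z : (cmod z == 0) = (z == 0).
Proof.
apply/eqP/eqP => [|->]; last exact: cmod0.
exact: ComplexField.Normc.eq0_normc.
Qed.

Lemma cmod_gt0 z : (0 < cmod z) = (z != 0).
Proof. by rewrite lt_def cmod_ge0 andbT cmod_eq0. Qed.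

Lemma cmodC x : cmod x%:C = `|x|.
Proof. by rewrite /= expr0n addr0 sqrtr_sqr. Qed.

Lemma cmodi : cmod ('i : R[i]) = 1.
Proof. by rewrite /= expr0n add0r expr1n sqrtr1. Qed.

Lemma Re_le_cmod z : `|Re z| <= cmod z.
Proof.
by rewrite -[leLHS]sqrtr_sqr; case: z => a b /=; rewrite ler_wsqrtr// lerDl sqr_ge0.
Qed.

Lemma Im_le_cmod z : `|Im z| <= cmod z.
Proof.
by rewrite -[leLHS]sqrtr_sqr; case: z => a b /=; rewrite ler_wsqrtr// lerDr sqr_ge0.
Qed.

Lemma cmod_le_ReIm z : cmod z <= `|Re z| + `|Im z|.
Proof.
rewrite -(@ler_pXn2r _ 2) ?nnegrE ?cmod_ge0 ?addr_ge0//.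
rewrite cmod_sqr sqrrD !real_normK ?num_real// addrAC lerDl.
by rewrite mulrn_wge0// mulr_ge0.
Qed.

Lemma cmod_lipschitz z w : cmod z <= cmod w + cmod (z - w).
Proof. by rewrite -{1}(subrK w z) addrC cmodD. Qed.

(* epsilon-delta complex derivative, with real epsilon and delta: the ambient
   normed structure on R[i] has complex-valued radii *)
Definition cdiff (F : R[i] -> R[i]) (z d : R[i]) : Prop :=
  forall e : R, 0 < e -> exists2 dl : R, 0 < dl &
    forall h, cmod h < dl -> cmod (F (z + h) - F z - d * h) <= e * cmod h.

(** Positivity in the partial order of [R[i]] forces the imaginary part to vanish; this turns the
    complex radii of neighbourhoods into real ones. *)
Lemma posc_real (d : R[i]) : 0 < d -> 0 < Re d /\ d = (Re d)%:C.
Proof.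
by case: d => a b; rewrite ltcE /= => /andP[/eqP -> a0]; split.
Qed.

Lemma derivable_cdiff (F : R[i] -> R[i]) z :
  derivable (F : R[i]^o -> R[i]^o) z 1 <-> exists d, cdiff F z d.
Proof.
split.
  move=> /cvg_ex[l] /cvgrPdist_le H; exists l => e e0.
  have e0C : (0 : R[i]) < e%:C by rewrite ltcR.
  have := H _ e0C => /nbhs_ballP[d /= d0 Hd].
  have [rd0 dE] := posc_real d0.
  exists (Re d) => // h hd.
  have [->|h0] := eqVneq h 0; first by rewrite addr0 mulr0 subr0 subrr cmod0 mulr0.
  have := Hd h; rewrite /ball /= sub0r normrN dE normE ltcR => /(_ hd h0).
  rewrite normE lecR => Hh.
  have hE : F (z + h) - F z - l * h =
    - (h * (l - h^-1 *: ((F : R[i]^o -> R[i]^o) (h *: (1 : R[i]^o) + z) - F z))).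
    rewrite /GRing.scale /= mulr1 (addrC h z); field.
    exact: h0.
  by rewrite hE cmodN cmodM mulrC ler_wpM2r// cmod_ge0.
move=> [d H]; apply/cvg_ex; exists d; apply/cvgrPdist_le => /= e e0.
have [re0 eE] := posc_real e0.
have [dl dl0 Hdl] := H _ re0.
apply/nbhs_ballP; exists dl%:C => /=; first by rewrite ltcR.
move=> h; rewrite /ball /= sub0r normrN normE ltcR => hd h0.
have := Hdl _ hd.
have hE : d - h^-1 *: ((F : R[i]^o -> R[i]^o) (h *: (1 : R[i]^o) + z) - F z) =
   - (h^-1 * (F (z + h) - F z - d * h)).
  rewrite /GRing.scale /= mulr1 (addrC h z); field.
  exact: h0.
move=> H0; rewrite hE normE eE lecR cmodN cmodM cmodV ler_pdivrMl ?cmod_gt0// [leRHS]mulrC.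
exact: H0.
Qed.

Lemma entireP (F : R[i] -> R[i]) : entire F <-> forall z, exists d, cdiff F z d.
Proof. by split=> H z; apply/derivable_cdiff/H. Qed.

Definition ccont (F : R[i] -> R[i]) z : Prop :=
  forall e : R, 0 < e -> exists2 dl : R, 0 < dl &
    forall w, cmod (w - z) < dl -> cmod (F w - F z) <= e.

Lemma cdiff_ccont F z d : cdiff F z d -> ccont F z.
Proof.
move=> H e e0; have [dl dl0 Hdl] := H 1 ltr01.
have C0 : 0 < 1 + cmod d by rewrite ltr_wpDr// cmod_ge0.
exists (Num.min dl (e / (1 + cmod d))).
  by rewrite lt_min dl0 divr_gt0.
move=> w; rewrite lt_min => /andP[w1 w2].
have := Hdl _ w1; rewrite mul1r (addrC z) subrK => H1.
apply: le_trans (_ : cmod (F w - F z - d * (w - z)) + cmod (d * (w - z)) <= _).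
  by rewrite -{1}(subrK (d * (w - z)) (F w - F z)) cmodD.
rewrite cmodM; move: w2; rewrite ltr_pdivlMr// => w2.
nra.
Qed.

Lemma cdiff_ext F G z d (r : R) : 0 < r ->
  (forall w, cmod (w - z) < r -> F w = G w) -> cdiff F z d -> cdiff G z d.
Proof.
move=> r0 FG H e e0; have [dl dl0 Hdl] := H e e0.
exists (Num.min dl r); first by rewrite lt_min dl0.
move=> h; rewrite lt_min => /andP[h1 h2].
rewrite -FG ?(addrC z) ?addrK// -(FG z) ?subrr ?cmod0//.
by rewrite addrC; exact: Hdl.
Qed.

Lemma cdiff_cst (c z : R[i]) : cdiff (fun=> c) z 0.
Proof.
move=> e e0; exists 1 => // h _.
by rewrite subrr mul0r subr0 cmod0 mulr_ge0 ?cmod_ge0// ltW.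
Qed.

Lemma cdiff_id (z : R[i]) : cdiff id z 1.
Proof.
move=> e e0; exists 1 => // h _.
by rewrite mul1r (addrC z) addrK subrr cmod0 mulr_ge0 ?cmod_ge0// ltW.
Qed.

Lemma cdiffD F G z a b : cdiff F z a -> cdiff G z b ->
  cdiff (fun w => F w + G w) z (a + b).
Proof.
move=> HF HG e e0; have e20 : 0 < e / 2 by rewrite divr_gt0.
have [d1 d10 H1] := HF _ e20; have [d2 d20 H2] := HG _ e20.
exists (Num.min d1 d2); first by rewrite lt_min d10.
move=> h; rewrite lt_min => /andP[h1 h2].
have -> : F (z + h) + G (z + h) - (F z + G z) - (a + b) * h =
  (F (z + h) - F z - a * h) + (G (z + h) - G z - b * h) by ring.
apply: (le_trans (cmodD _ _)).
have := H1 _ h1; have := H2 _ h2; lra.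
Qed.

Lemma ccont_bound F z : ccont F z -> exists2 dl : R, 0 < dl &
  forall w, cmod (w - z) < dl -> cmod (F w) <= cmod (F z) + 1.
Proof.
move=> H; have [d d0 Hd] := H 1 ltr01; exists d => // w /Hd ?.
by apply: le_trans (cmod_lipschitz _ (F z)) _; rewrite lerD2l.
Qed.

Lemma cdiffM F G z a b : cdiff F z a -> cdiff G z b ->
  cdiff (fun w => F w * G w) z (a * G z + F z * b).
Proof.
move=> HF HG e e0.
(* [C] dominates the factor beside each small quantity in the three error terms below
   ([cmod (G (z + h))] is at most [cmod (G z) + 1]), so a tolerance [e / (3 * C)] leaves a third of
   the error to each. *)
set C := cmod a + cmod (F z) + cmod (G z) + 2.
have C0 : 0 < C by rewrite /C; have := cmod_ge0 a; have := cmod_ge0 (F z);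
  have := cmod_ge0 (G z); lra.
have eC : 0 < e / (3 * C) by rewrite divr_gt0// mulr_gt0.
have [d1 d10 H1] := HF _ eC; have [d2 d20 H2] := HG _ eC.
have [d3 d30 H3] := cdiff_ccont HG eC.
have [d4 d40 H4] := ccont_bound (cdiff_ccont HG).
exists (Num.min (Num.min d1 d2) (Num.min d3 d4)).
  by rewrite !lt_min d10 d20 d30.
move=> h; rewrite !lt_min => /andP[/andP[h1 h2] /andP[h3 h4]].
have -> : F (z + h) * G (z + h) - F z * G z - (a * G z + F z * b) * h =
  (F (z + h) - F z - a * h) * G (z + h) + F z * (G (z + h) - G z - b * h)
  + a * h * (G (z + h) - G z) by ring.
have {}H1 := H1 _ h1; have {}H2 := H2 _ h2.
have {}H3 : cmod (G (z + h) - G z) <= e / (3 * C).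
  by apply: H3; rewrite (addrC z) addrK.
have {}H4 : cmod (G (z + h)) <= cmod (G z) + 1.
  by apply: H4; rewrite (addrC z) addrK.
apply: (le_trans (cmodD _ _)); rewrite !cmodM.
have := cmodD ((F (z + h) - F z - a * h) * G (z + h))
   (F z * (G (z + h) - G z - b * h)); rewrite !cmodM => H5.
set X := cmod (F (z + h) - F z - a * h) in H1 H5 *.
set Y := cmod (G (z + h) - G z - b * h) in H2 H5 *.
set Z := cmod (G (z + h) - G z) in H3 *.
set V := cmod (G (z + h)) in H4 H5 *.
have hp := cmod_ge0 h.
have Cz : C != 0 by rewrite gt_eqF.
have eE : e * cmod h = 3 * C * (e / (3 * C) * cmod h) by field.
rewrite eE.
set t := e / (3 * C) in H1 H2 H3 eC *.
have E1 : X * V <= t * cmod h * C.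
  apply: ler_pM; rewrite ?cmod_ge0//; apply: le_trans H4 _; rewrite /C.
  by have := cmod_ge0 a; have := cmod_ge0 (F z); lra.
have E2 : cmod (F z) * Y <= C * (t * cmod h).
  apply: ler_pM; rewrite ?cmod_ge0//; rewrite /C.
  by have := cmod_ge0 a; have := cmod_ge0 (G z); lra.
have E3 : cmod a * cmod h * Z <= C * cmod h * t.
  apply: ler_pM; rewrite ?mulr_ge0 ?cmod_ge0// ler_wpM2r// /C.
  by have := cmod_ge0 (F z); have := cmod_ge0 (G z); lra.
lra.
Qed.

Lemma cdiffV F z a : F z != 0 -> cdiff F z a ->
  cdiff (fun w => (F w)^-1) z (- a / F z ^+ 2).
Proof.
move=> Fz0 HF e e0.
have m0 : 0 < cmod (F z) by rewrite cmod_gt0.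
set m := cmod (F z) in m0.
(* The tolerances are fitted to [cmod (F (z + h)) >= m / 2]: the two error terms have denominators
   at least m^2 / 2 and m^3 / 2, and each comes out at most [e / 2 * cmod h]. *)
have eC : 0 < e * m ^+ 2 / 4 by rewrite divr_gt0// mulr_gt0// exprn_gt0.
have [d1 d10 H1] := HF _ eC.
have m2 : 0 < m / 2 by rewrite divr_gt0.
have [d2 d20 H2] := cdiff_ccont HF m2.
have eD : 0 < e * m ^+ 3 / (4 * (cmod a + 1)).
  by rewrite divr_gt0// ?mulr_gt0// ?exprn_gt0// ltr_wpDl// cmod_ge0.
have [d3 d30 H3] := cdiff_ccont HF eD.
exists (Num.min d1 (Num.min d2 d3)); first by rewrite !lt_min d10 d20.
move=> h; rewrite !lt_min => /andP[h1 /andP[h2 h3]].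
have {}H1 := H1 _ h1.
have {}H2 : cmod (F (z + h) - F z) <= m / 2 by apply: H2; rewrite (addrC z) addrK.
have {}H3 : cmod (F (z + h) - F z) <= e * m ^+ 3 / (4 * (cmod a + 1)).
  by apply: H3; rewrite (addrC z) addrK.
have mh : m / 2 <= cmod (F (z + h)).
  have := cmod_lipschitz (F z) (F (z + h)).
  by rewrite (cmod_distC (F z)) -/m; lra.
have Fh0 : F (z + h) != 0 by rewrite -cmod_gt0; lra.
have -> : (F (z + h))^-1 - (F z)^-1 - - a / F z ^+ 2 * h =
  - ((F (z + h) - F z - a * h) / (F z * F (z + h)))
   + a * h * (F (z + h) - F z) / (F z ^+ 2 * F (z + h)).
  by field; rewrite Fz0 Fh0.
apply: (le_trans (cmodD _ _)); rewrite cmodN !cmodM !cmodV !cmodM -/m -expr2.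
set X := cmod (F (z + h) - F z - a * h) in H1 *.
set Y := cmod (F (z + h) - F z) in H2 H3 *.
set M := cmod (F (z + h)) in mh *.
have M0 : 0 < M by lra.
have hp := cmod_ge0 h.
have E1 : X / (m * M) <= e / 2 * cmod h.
  rewrite ler_pdivrMr ?mulr_gt0//.
  have : m ^+ 2 / 2 <= m * M by rewrite expr2; nra.
  move=> E; have := ler_wpM2l (mulr_ge0 (ltW e0) hp) E; lra.
have E2 : cmod a * cmod h * Y / (m ^+ 2 * M) <= e / 2 * cmod h.
  rewrite ler_pdivrMr ?mulr_gt0// ?exprn_gt0//.
  have a0 := cmod_ge0 a.
  have A1 : (cmod a + 1) * Y <= e * m ^+ 3 / 4.
    have := ler_wpM2l (_ : 0 <= cmod a + 1) H3; rewrite addr_ge0// => /(_ isT).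
    suff -> : (cmod a + 1) * (e * m ^+ 3 / (4 * (cmod a + 1))) = e * m ^+ 3 / 4 by [].
    by field; rewrite gt_eqF// ltr_wpDl.
  have A2 : cmod a * Y <= e * m ^+ 3 / 4.
    by apply: le_trans A1; rewrite ler_wpM2r ?cmod_ge0// lerDl.
  have A3 : m ^+ 3 / 2 <= m ^+ 2 * M.
    by rewrite exprSr -mulrA ler_wpM2l// exprn_ge0// ltW.
  have B1 := ler_wpM2r hp A2.
  have B2 := ler_wpM2l (mulr_ge0 (ltW e0) hp) A3.
  lra.
lra.
Qed.

Lemma cdiff_comp_affine F (a b z d : R[i]) : cdiff F (a * z + b) d ->
  cdiff (fun w => F (a * w + b)) z (d * a).
Proof.
move=> H e e0.
have a0 := cmod_ge0 a.
have ca : 0 < cmod a + 1 by lra.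
have [dl dl0 Hd] := H (e / (cmod a + 1)) (divr_gt0 e0 ca).
exists (dl / (cmod a + 1)); first exact: divr_gt0.
move=> h; rewrite ltr_pdivlMr// => hd.
have hp := cmod_ge0 h.
have ah : cmod (a * h) < dl by rewrite cmodM; nra.
have := Hd _ ah.
have -> : a * z + b + a * h = a * (z + h) + b by ring.
rewrite mulrA => /le_trans; apply.
rewrite cmodM mulrAC ler_pdivrMr//.
have := mulr_ge0 (ltW e0) hp; nra.
Qed.

Lemma entire_ccont (F : R[i] -> R[i]) z : entire F -> ccont F z.
Proof. by move/entireP/(_ z) => [d /cdiff_ccont]. Qed.

End ComplexModulus.

(** * Integrals along rectangles *)

Section CurveIntegral.
Context {R : realType}.
Implicit Types (f g : R -> R[i]) (a b c d x y : R).

Local Notation mu := (@lebesgue_measure R).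
Local Notation Re := (@complex.Re R).
Local Notation Im := (@complex.Im R).

(** Continuity is asked on the whole line, not on the segment of integration, so that integrability
    on every segment and cutting a segment in two need no relative topology. *)
Definition rcont f : Prop := forall x e, 0 < e -> exists2 dl : R, 0 < dl &
  forall y, `|y - x| < dl -> cmod (f y - f x) <= e.

Lemma rcont_ReIm f : rcont f ->
  continuous (fun x => Re (f x)) /\ continuous (fun x => Im (f x)).
Proof.
move=> cf; split=> x; apply/cvgrPdist_le => e e0.
- have [dl dl0 H] := cf x e e0.
  apply/nbhs_ballP; exists dl => //= y; rewrite /ball /= distrC => /H fe.
  rewrite distrC; apply: le_trans fe; apply: le_trans (Re_le_cmod _).
  by case: (f y) (f x) => ? ? [? ?].
- have [dl dl0 H] := cf x e e0.
  apply/nbhs_ballP; exists dl => //= y; rewrite /ball /= distrC => /H fe.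
  rewrite distrC; apply: le_trans fe; apply: le_trans (Im_le_cmod _).
  by case: (f y) (f x) => ? ? [? ?].
Qed.

Lemma rcontD f g : rcont f -> rcont g -> rcont (fun x => f x + g x).
Proof.
move=> cf cg x e e0; have e2 : 0 < e / 2 by rewrite divr_gt0.
have [d1 d10 H1] := cf x _ e2; have [d2 d20 H2] := cg x _ e2.
exists (Num.min d1 d2); first by rewrite lt_min d10.
move=> y; rewrite lt_min => /andP[y1 y2]; rewrite opprD addrACA.
by apply: le_trans (cmodD _ _) _; have := H1 _ y1; have := H2 _ y2; lra.
Qed.

Lemma rcontZ (k : R[i]) f : rcont f -> rcont (fun x => k * f x).
Proof.
move=> cf x e e0; have k0 := cmod_ge0 k.
have K0 : 0 < cmod k + 1 by lra.
have [d1 d10 H1] := cf x _ (divr_gt0 e0 K0).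
exists d1 => // y /H1; rewrite -mulrBr cmodM ler_pdivlMr//.
have := cmod_ge0 (f y - f x); nra.
Qed.

Lemma rcont_cst (k : R[i]) : rcont (fun=> k).
Proof. by move=> x e e0; exists 1 => // y _; rewrite subrr cmod0 ltW. Qed.

Lemma rcontB f g : rcont f -> rcont g -> rcont (fun x => f x - g x).
Proof.
move=> cf cg; have := rcontD cf (rcontZ (-1) cg).
by under eq_fun do rewrite mulN1r.
Qed.

Definition cint f a b : R[i] :=
  (\int[mu]_(x in `[a, b]) Re (f x)) +i* (\int[mu]_(x in `[a, b]) Im (f x)).

Lemma continuous_integrable_itv (h : R -> R) a b : continuous h ->
  mu.-integrable `[a, b] (EFin \o h).
Proof.
move=> ch; apply: continuous_compact_integrable; first exact: segment_compact.
exact: continuous_subspaceT.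
Qed.

Lemma cintD f g a b : rcont f -> rcont g ->
  cint (fun x => f x + g x) a b = cint f a b + cint g a b.
Proof.
move=> /rcont_ReIm[f1 f2] /rcont_ReIm[g1 g2]; rewrite /cint.
have E1 : \int[mu]_(x in `[a, b]) Re (f x + g x) =
  \int[mu]_(x in `[a, b]) (Re (f x) + Re (g x)).
  by apply: eq_Rintegral => x _; case: (f x) (g x) => ? ? [? ?].
have E2 : \int[mu]_(x in `[a, b]) Im (f x + g x) =
  \int[mu]_(x in `[a, b]) (Im (f x) + Im (g x)).
  by apply: eq_Rintegral => x _; case: (f x) (g x) => ? ? [? ?].
by rewrite E1 E2 !RintegralD//; exact: continuous_integrable_itv.
Qed.

Lemma cintZ (k : R[i]) f a b : rcont f ->
  cint (fun x => k * f x) a b = k * cint f a b.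
Proof.
move=> /rcont_ReIm[f1 f2]; case: k => k1 k2; rewrite /cint.
have iR := continuous_integrable_itv a b f1.
have iI := continuous_integrable_itv a b f2.
have iZ (r : R) (h : R -> R) : mu.-integrable `[a, b] (EFin \o h) ->
   mu.-integrable `[a, b] (EFin \o (fun x => r * h x)).
  by move=> ih; apply: (integrableZl _ r ih).
have E1 : \int[mu]_(x in `[a, b]) Re ((k1 +i* k2) * f x) =
  \int[mu]_(x in `[a, b]) (k1 * Re (f x) - k2 * Im (f x)).
  by apply: eq_Rintegral => x _; case: (f x).
have E2 : \int[mu]_(x in `[a, b]) Im ((k1 +i* k2) * f x) =
  \int[mu]_(x in `[a, b]) (k1 * Im (f x) + k2 * Re (f x)).
  by apply: eq_Rintegral => x _; case: (f x) => ? ? /=; ring.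
rewrite E1 E2 RintegralB ?RintegralD//; try exact: iZ.
rewrite !RintegralZl//.
Qed.

Lemma cintB f g a b : rcont f -> rcont g ->
  cint (fun x => f x - g x) a b = cint f a b - cint g a b.
Proof.
move=> cf cg; rewrite -[- cint g a b]mulN1r -cintZ// -cintD//; last exact: rcontZ.
by congr cint; apply/funext => x; rewrite mulN1r.
Qed.

Lemma fine_lebesgue_itv a b : a <= b -> fine (mu `[a, b]) = b - a.
Proof.
move=> ab; rewrite lebesgue_measure_itv/= lte_fin; case: ltP => // ba.
have -> : a = b by apply/eqP; rewrite eq_le ab ba.
by rewrite subrr.
Qed.

Lemma cint_cst (k : R[i]) a b : a <= b -> cint (fun=> k) a b = (b - a)%:C * k.
Proof.
move=> ab; rewrite /cint !Rintegral_cst// fine_lebesgue_itv//.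
by case: k => k1 k2; apply/eqP; rewrite eq_complex /=; apply/andP; split; apply/eqP; ring.
Qed.

Lemma Rintegral_itv_split (h : R -> R) a c b : continuous h -> a <= c -> c <= b ->
  \int[mu]_(x in `[a, b]) h x =
  \int[mu]_(x in `[a, c]) h x + \int[mu]_(x in `[c, b]) h x.
Proof.
move=> ch ac cb.
have := @Rintegral_itvB R h (BLeft a) (BRight b) c
  (continuous_integrable_itv _ _ ch).
rewrite !bnd_simp => /(_ ac cb) H.
rewrite -(@Rintegral_itv_obnd_cbnd _ c (BRight b)); last first.
  apply: (integrableS _ _ _ (continuous_integrable_itv c b ch)) => //.
  by apply: subset_itvr; rewrite bnd_simp.
by rewrite -H addrC subrK.
Qed.

Lemma cint_split f a c b : rcont f -> a <= c -> c <= b ->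
  cint f a b = cint f a c + cint f c b.
Proof.
move=> /rcont_ReIm[f1 f2] ac cb; rewrite /cint.
by rewrite (Rintegral_itv_split f1 ac cb) (Rintegral_itv_split f2 ac cb).
Qed.

Lemma Rintegral_itv_bound (h : R -> R) a b M : continuous h -> a <= b ->
  (forall x, a <= x <= b -> `|h x| <= M) ->
  `|\int[mu]_(x in `[a, b]) h x| <= M * (b - a).
Proof.
move=> ch ab hM.
have ih := continuous_integrable_itv a b ch.
apply: le_trans (le_normr_Rintegral _ ih) _ => //.
have -> : M * (b - a) = \int[mu]_(x in `[a, b]) M.
  by rewrite Rintegral_cst//; congr (_ * _); rewrite -(fine_lebesgue_itv ab).
apply: le_Rintegral => //.
- apply: continuous_integrable_itv => x.
  by apply: (@continuous_comp _ _ _ h Num.norm); [exact: ch|exact: norm_continuous].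
- by apply: continuous_integrable_itv => x; exact: cst_continuous.
Qed.

(** The real and imaginary parts are bounded separately, which costs the factor 2; the later
    estimates only need some constant. *)
Lemma cint_bound f a b M : rcont f -> a <= b ->
  (forall x, a <= x <= b -> cmod (f x) <= M) ->
  cmod (cint f a b) <= 2 * M * (b - a).
Proof.
move=> /rcont_ReIm[f1 f2] ab H; apply: le_trans (cmod_le_ReIm _) _.
have -> : 2 * M * (b - a) = M * (b - a) + M * (b - a) by ring.
apply: lerD; apply: Rintegral_itv_bound => // x /H; apply: le_trans.
  exact: Re_le_cmod.
exact: Im_le_cmod.
Qed.

End CurveIntegral.

(** * Rectangle integrals: cutting, bounds, and the ingredients of bisection *)

Section Goursat.
Context {R : realType}.
Implicit Types (g : R[i] -> R[i]) (a b c d x y : R).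

Lemma rcont_hline g c : (forall x, ccont g (x +i* c)) -> rcont (fun x => g (x +i* c)).
Proof.
move=> cg x e e0; have [dl dl0 H] := cg x e e0; exists dl => // y yx; apply: H.
have -> : (y +i* c) - (x +i* c) = (y - x)%:C.
  by apply/eqP; rewrite eq_complex /= subrr !eqxx.
by rewrite cmodC.
Qed.

Lemma rcont_vline g a : (forall y, ccont g (a +i* y)) -> rcont (fun y => g (a +i* y)).
Proof.
move=> cg x e e0; have [dl dl0 H] := cg x e e0; exists dl => // y yx; apply: H.
have -> : (a +i* y) - (a +i* x) = 'i * (y - x)%:C.
  by apply/eqP; rewrite eq_complex /=; apply/andP; split; apply/eqP; ring.
by rewrite cmodM cmodi mul1r cmodC.
Qed.

(* counterclockwise integral of g along the boundary of [a, b] x [c, d] *)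
Definition rint g a b c d : R[i] :=
  cint (fun x => g (x +i* c) - g (x +i* d)) a b
  + 'i * cint (fun y => g (b +i* y) - g (a +i* y)) c d.

Lemma rint_split_re g a m b c d : (forall z, ccont g z) -> a <= m -> m <= b ->
  rint g a b c d = rint g a m c d + rint g m b c d.
Proof.
move=> cg am mb; rewrite /rint.
have ch k := rcont_hline (c := k) (fun x => cg _).
have cv k := rcont_vline (a := k) (fun x => cg _).
rewrite (cint_split _ am mb); last exact: rcontB.
have -> : cint (fun y => g (b +i* y) - g (a +i* y)) c d =
  cint (fun y => g (m +i* y) - g (a +i* y)) c d +
  cint (fun y => g (b +i* y) - g (m +i* y)) c d.
  rewrite -cintD; [|exact: rcontB|exact: rcontB].
  by congr cint; apply/funext => y; ring.
by ring.
Qed.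

Lemma rint_split_im g a b c m d : (forall z, ccont g z) -> c <= m -> m <= d ->
  rint g a b c d = rint g a b c m + rint g a b m d.
Proof.
move=> cg am mb; rewrite /rint.
have ch k := rcont_hline (c := k) (fun x => cg _).
have cv k := rcont_vline (a := k) (fun x => cg _).
rewrite (cint_split _ am mb); last exact: rcontB.
have -> : cint (fun x => g (x +i* c) - g (x +i* d)) a b =
  cint (fun x => g (x +i* c) - g (x +i* m)) a b +
  cint (fun x => g (x +i* m) - g (x +i* d)) a b.
  rewrite -cintD; [|exact: rcontB|exact: rcontB].
  by congr cint; apply/funext => y; ring.
by ring.
Qed.

Lemma rint_bound g a b c d M : (forall z, ccont g z) -> a <= b -> c <= d ->
  (forall x y, a <= x <= b -> c <= y <= d -> cmod (g (x +i* y)) <= M) ->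
  cmod (rint g a b c d) <= 4 * M * ((b - a) + (d - c)).
Proof.
move=> cg ab cd gM.
have ch k := rcont_hline (c := k) (fun x => cg _).
have cv k := rcont_vline (a := k) (fun x => cg _).
have B1 : cmod (cint (fun x => g (x +i* c) - g (x +i* d)) a b) <= 2 * (2 * M) * (b - a).
  apply: cint_bound => //; first exact: rcontB.
  move=> x xab; apply: le_trans (cmodB _ _) _.
  have := gM x c xab; have := gM x d xab; rewrite !lexx cd => /(_ isT) ? /(_ isT) ?; lra.
have B2 : cmod (cint (fun y => g (b +i* y) - g (a +i* y)) c d) <= 2 * (2 * M) * (d - c).
  apply: cint_bound => //; first exact: rcontB.
  move=> x xab; apply: le_trans (cmodB _ _) _.
  have := gM a x; have := gM b x; rewrite !lexx ab => /(_ isT xab) ? /(_ isT xab) ?; lra.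
apply: le_trans (cmodD _ _) _; rewrite cmodM cmodi mul1r; lra.
Qed.

Lemma ccont_affine (A D z : R[i]) : ccont (fun w => A + D * w) z.
Proof.
by apply: cdiff_ccont (cdiffD (cdiff_cst A z) (cdiffM (cdiff_cst D z) (cdiff_id z))).
Qed.

Lemma rint_affine_sub g (A D : R[i]) a b c d : (forall z, ccont g z) -> a <= b -> c <= d ->
  rint (fun w => g w - (A + D * w)) a b c d = rint g a b c d.
Proof.
move=> cg ab cd; rewrite /rint.
have ch k := rcont_hline (c := k) (fun x => cg _).
have cv k := rcont_vline (a := k) (fun x => cg _).
have -> : (fun x => g (x +i* c) - (A + D * (x +i* c)) - (g (x +i* d) - (A + D * (x +i* d))))
  = (fun x => (g (x +i* c) - g (x +i* d)) - (D * ('i * (c - d)%:C))).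
  apply/funext => x.
  have -> : 'i * (c - d)%:C = (x +i* c) - (x +i* d) :> R[i].
    by apply/eqP; rewrite eq_complex /=; apply/andP; split; apply/eqP; ring.
  by ring.
have -> : (fun y => g (b +i* y) - (A + D * (b +i* y)) - (g (a +i* y) - (A + D * (a +i* y))))
  = (fun y => (g (b +i* y) - g (a +i* y)) - D * (b - a)%:C).
  apply/funext => y.
  have -> : (b - a)%:C = (b +i* y) - (a +i* y) :> R[i].
    by apply/eqP; rewrite eq_complex /=; apply/andP; split; apply/eqP; ring.
  by ring.
rewrite (cintB _ _ (rcontB (ch _) (ch _)) (rcont_cst _)).
rewrite (cintB _ _ (rcontB (cv _) (cv _)) (rcont_cst _)) !cint_cst//.
have -> : (c - d)%:C = - (d - c)%:C :> R[i] by rewrite -rmorphN opprB.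
by ring.
Qed.

(** The integral is the sum of those over the four quarters, so one quarter has at least a fourth of
    the modulus. Rectangles are recorded by their lower left corner [p], since the side lengths are
    known at each stage of the bisection. *)
Lemma rint_quarter g (w h : R) (p : R * R) : (forall z, ccont g z) -> 0 <= w -> 0 <= h ->
  exists p' : R * R,
  [/\ p.1 <= p'.1, p'.1 + w / 2 <= p.1 + w, p.2 <= p'.2, p'.2 + h / 2 <= p.2 + h &
   cmod (rint g p.1 (p.1 + w) p.2 (p.2 + h)) <=
   4 * cmod (rint g p'.1 (p'.1 + w / 2) p'.2 (p'.2 + h / 2))].
Proof.
case: p => a c /= cg w0 h0.
have H : rint g a (a + w) c (c + h) =
  (rint g a (a + w / 2) c (c + h / 2) + rint g a (a + w / 2) (c + h / 2) (c + h / 2 + h / 2))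
  + (rint g (a + w / 2) (a + w / 2 + w / 2) c (c + h / 2)
   + rint g (a + w / 2) (a + w / 2 + w / 2) (c + h / 2) (c + h / 2 + h / 2)).
  have -> : a + w = a + w / 2 + w / 2 by field.
  have -> : c + h = c + h / 2 + h / 2 by field.
  rewrite (@rint_split_re g a (a + w / 2) (a + w / 2 + w / 2)) //; [|lra|lra].
  rewrite (@rint_split_im g a _ c (c + h / 2) (c + h / 2 + h / 2)) //; [|lra|lra].
  by rewrite (@rint_split_im g (a + w / 2) _ c (c + h / 2) (c + h / 2 + h / 2)) //; [lra|lra].
have HN : cmod (rint g a (a + w) c (c + h)) <=
  (cmod (rint g a (a + w / 2) c (c + h / 2))
   + cmod (rint g a (a + w / 2) (c + h / 2) (c + h / 2 + h / 2)))
  + (cmod (rint g (a + w / 2) (a + w / 2 + w / 2) c (c + h / 2))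
   + cmod (rint g (a + w / 2) (a + w / 2 + w / 2) (c + h / 2) (c + h / 2 + h / 2))).
  rewrite H; apply: le_trans (cmodD _ _) _; apply: lerD; exact: cmodD.
set N := cmod (rint g a (a + w) c (c + h)) in HN *.
have hw : a <= a + w / 2 /\ a + w / 2 + w / 2 <= a + w by clear -w0; split; lra.
have hh : c <= c + h / 2 /\ c + h / 2 + h / 2 <= c + h by clear -h0; split; lra.
have hw' : a + w / 2 <= a + w by clear -w0; lra.
have hh' : c + h / 2 <= c + h by clear -h0; lra.
case: hw hh => hw1 hw2 [hh1 hh2].
have [H1|H1] := lerP N (4 * cmod (rint g a (a + w / 2) c (c + h / 2))).
  by exists (a, c).
have [H2|H2] := lerP N (4 * cmod (rint g a (a + w / 2) (c + h / 2) (c + h / 2 + h / 2))).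
  by exists (a, c + h / 2).
have [H3|H3] := lerP N (4 * cmod (rint g (a + w / 2) (a + w / 2 + w / 2) c (c + h / 2))).
  by exists (a + w / 2, c).
exists (a + w / 2, c + h / 2); split; [exact: hw1|exact: hw2|exact: hh1|exact: hh2|].
change (N <= 4 * cmod (rint g (a + w / 2) (a + w / 2 + w / 2) (c + h / 2) (c + h / 2 + h / 2))).
move: HN H1 H2 H3; clear; set x1 := cmod _; set x2 := cmod _; set x3 := cmod _.
by set x4 := cmod _; move: N x1 x2 x3 x4 => *; lra.
Qed.

(** Every left endpoint lies below every right endpoint, so the supremum of the left endpoints lies
    in all the intervals. *)
Lemma nested_itv_point (s : nat -> R) (w : R) :
  (forall n, s n <= s n.+1) ->
  (forall n, s n.+1 + w / 2 ^+ n.+1 <= s n + w / 2 ^+ n) -> 0 <= w ->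
  exists x, forall n, s n <= x <= s n + w / 2 ^+ n.
Proof.
move=> s1 s2 w0.
have pw n : 0 <= w / 2 ^+ n by rewrite divr_ge0// exprn_ge0.
have inc m k : s m <= s (m + k)%N.
  elim: k => [|k IH]; first by rewrite addn0.
  by rewrite addnS; apply: le_trans IH (s1 _).
have dec m k : s (m + k)%N + w / 2 ^+ (m + k) <= s m + w / 2 ^+ m.
  elim: k => [|k IH]; first by rewrite addn0.
  by rewrite addnS; apply: le_trans (s2 _) IH.
have cross m n : s m <= s n + w / 2 ^+ n.
  have [mn|nm] := leqP m n.
    by have := inc m (n - m)%N; rewrite subnKC// => ?; have := pw n; lra.
  by have := dec n (m - n)%N; rewrite subnKC ?(ltnW nm)// => ?; have := pw m; lra.
have hs : has_sup (range s).
  split; first by exists (s 0%N), 0%N.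
  by exists (s 0%N + w / 2 ^+ 0) => _ [m _ <-]; exact: cross.
exists (sup (range s)) => n; apply/andP; split.
  by apply: ub_le_sup; [exact: hs.2|exists n].
by apply: ge_sup; [exists (s 0%N), 0%N | move=> _ [m _ <-]; exact: cross].
Qed.

Lemma div_exp2_lt (w e : R) : 0 < e -> exists n, w / 2 ^+ n < e.
Proof.
move=> e0; have [n Hn] : exists n : nat, w / e < n%:R.
  exists (Num.bound `|w / e|); apply: le_lt_trans (ler_norm _) _.
  exact: archi_boundP.
exists n; rewrite ltr_pdivrMr ?exprn_gt0// mulrC -ltr_pdivrMr//.
apply: lt_le_trans Hn _; rewrite -natrX ler_nat.
by apply: ltnW; exact: ltn_expl.
Qed.

End Goursat.

(** * Goursat's theorem, with one exceptional interior point allowed *)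

Section GoursatTheorem.
Context {R : realType}.
Implicit Types (g : R[i] -> R[i]) (a b c d x y : R).

Lemma ccontD (F G : R[i] -> R[i]) z : ccont F z -> ccont G z -> ccont (fun w => F w + G w) z.
Proof.
move=> cF cG e e0; have e2 : 0 < e / 2 by rewrite divr_gt0.
have [d1 d10 H1] := cF _ e2; have [d2 d20 H2] := cG _ e2.
exists (Num.min d1 d2); first by rewrite lt_min d10.
move=> w; rewrite lt_min => /andP[/H1 w1 /H2 w2]; rewrite opprD addrACA.
by apply: le_trans (cmodD _ _) _; lra.
Qed.

(** Bisection: n steps multiply the bound by 4^n, and shrink the rectangle by 2^n around a limit
    point. Subtracting the first-order expansion there does not change the integral and leaves an
    integrand of order 2^-n on a boundary of length of order 2^-n, which compensates 4^n. *)
Lemma goursat_rect g a b c d : (forall z, ccont g z) -> a <= b -> c <= d ->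
  (forall x y, a <= x <= b -> c <= y <= d -> exists D, cdiff g (x +i* y) D) ->
  rint g a b c d = 0.
Proof.
move=> cg ab cd Hd.
pose w := b - a; pose h := d - c.
have w0 : 0 <= w by rewrite subr_ge0.
have h0 : 0 <= h by rewrite subr_ge0.
have pw n : 0 <= w / 2 ^+ n by rewrite divr_ge0// exprn_ge0.
have ph n : 0 <= h / 2 ^+ n by rewrite divr_ge0// exprn_ge0.
have [nxt Hnxt] := choice (fun q : nat * (R * R) =>
   rint_quarter q.2 cg (pw q.1) (ph q.1)).
pose s := fix s n := if n is m.+1 then nxt (m, s m) else (a, c).
have half (t : R) n : t / 2 ^+ n / 2 = t / 2 ^+ n.+1.
  by rewrite exprSr invfM mulrA.
have Hs n := Hnxt (n, s n).
have S1 n : (s n).1 <= (s n.+1).1 by have [] := Hs n.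
have S2 n : (s n.+1).1 + w / 2 ^+ n.+1 <= (s n).1 + w / 2 ^+ n.
  by rewrite -half; have [] := Hs n.
have S3 n : (s n).2 <= (s n.+1).2 by have [] := Hs n.
have S4 n : (s n.+1).2 + h / 2 ^+ n.+1 <= (s n).2 + h / 2 ^+ n.
  by rewrite -half; have [] := Hs n.
pose I n := rint g (s n).1 ((s n).1 + w / 2 ^+ n) (s n).2 ((s n).2 + h / 2 ^+ n).
have S5 n : cmod (I n) <= 4 * cmod (I n.+1).
  by rewrite /I -!half; have [] := Hs n.
have I0 : I 0%N = rint g a b c d by rewrite /I /= !divr1 /w /h !(addrC _ (_ - _)) !subrK.
have S6 n : cmod (rint g a b c d) <= 4 ^+ n * cmod (I n).
  elim: n => [|n IH]; first by rewrite I0 expr0 mul1r.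
  apply: le_trans IH _; rewrite exprSr -mulrA ler_wpM2l// exprn_ge0//.
have [x Hx] := nested_itv_point S1 S2 w0.
have [y Hy] := nested_itv_point S3 S4 h0.
have xab : a <= x <= b by have := Hx 0%N; rewrite /= divr1 /w addrC subrK.
have ycd : c <= y <= d by have := Hy 0%N; rewrite /= divr1 /h addrC subrK.
have [D HD] := Hd _ _ xab ycd.
apply/eqP; rewrite -cmod_eq0 eq_le cmod_ge0 andbT.
apply/ler_addgt0Pr => e e0; rewrite add0r.
(* 4 (w + h)^2 is what remains of the bound once 4^n has cancelled; the added 1 keeps [T] positive
   for a degenerate rectangle. *)
pose T := 4 * (w + h) ^+ 2 + 1.
have T0 : 0 < T by rewrite ltr_wpDl// mulr_ge0// sqr_ge0.
have [dl dl0 Hdl] := HD _ (divr_gt0 e0 T0).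
have [n Hn] := div_exp2_lt (w + h) dl0.
apply: le_trans (S6 n) _.
pose r := fun z => g z - ((g (x +i* y) - D * (x +i* y)) + D * z).
have -> : I n = rint r (s n).1 ((s n).1 + w / 2 ^+ n) (s n).2 ((s n).2 + h / 2 ^+ n).
  rewrite /r rint_affine_sub//.
    by have := pw n; lra.
  by have := ph n; lra.
have cr z : ccont r z.
  have := ccontD (cg z) (ccont_affine (- (g (x +i* y) - D * (x +i* y))) (- D) z).
  by congr ccont; apply/funext => v; rewrite /r; ring.
have Q := @rint_bound R r (s n).1 ((s n).1 + w / 2 ^+ n) (s n).2 ((s n).2 + h / 2 ^+ n)
  (e / T * ((w + h) / 2 ^+ n)) cr.
have {}Q : cmod (rint r (s n).1 ((s n).1 + w / 2 ^+ n) (s n).2 ((s n).2 + h / 2 ^+ n))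
   <= 4 * (e / T * ((w + h) / 2 ^+ n)) * ((w + h) / 2 ^+ n).
  apply: le_trans (Q _ _ _) _.
  - by have := pw n; lra.
  - by have := ph n; lra.
  - move=> x' y' xs ys.
    have E : r (x' +i* y') = g ((x +i* y) + ((x' - x) +i* (y' - y))) - g (x +i* y)
         - D * ((x' - x) +i* (y' - y)).
      have -> : (x +i* y) + ((x' - x) +i* (y' - y)) = x' +i* y' :> R[i].
        by apply/eqP; rewrite eq_complex /=; apply/andP; split; apply/eqP; ring.
      have -> : ((x' - x) +i* (y' - y)) = (x' +i* y') - (x +i* y) :> R[i].
        by apply/eqP; rewrite eq_complex /=; apply/andP; split; apply/eqP; ring.
      by rewrite /r; ring.
    have B : cmod ((x' - x) +i* (y' - y)) <= (w + h) / 2 ^+ n.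
      apply: le_trans (cmod_le_ReIm _) _; rewrite mulrDl /=; apply: lerD.
        by rewrite ler_norml; move: xs (Hx n) => /andP[? ?] /andP[? ?]; apply/andP; split; lra.
      by rewrite ler_norml; move: ys (Hy n) => /andP[? ?] /andP[? ?]; apply/andP; split; lra.
    rewrite E; apply: le_trans (Hdl _ (le_lt_trans B Hn)) _.
    by rewrite ler_wpM2l// divr_ge0// ltW.
  - rewrite [X in _ * X <= _](_ : _ = (w + h) / 2 ^+ n)//.
    by rewrite [RHS]mulrDl; move: (s n).1 (s n).2 (w / 2 ^+ n) (h / 2 ^+ n) => *; ring.
apply: le_trans (ler_wpM2l _ Q) _; first by rewrite exprn_ge0.
have -> : 4 ^+ n * (4 * (e / T * ((w + h) / 2 ^+ n)) * ((w + h) / 2 ^+ n)) =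
   e * ((4 * (w + h) ^+ 2) / T).
  have -> : (4 : R) ^+ n = 2 ^+ n * 2 ^+ n by rewrite -exprMn; congr (_ ^+ _); ring.
  by field; rewrite expf_neq0 ?gt_eqF.
rewrite ger_pMr// ler_pdivrMr// mul1r /T; lra.
Qed.

(** Cutting out a small square around [z0] leaves four rectangles on which [goursat_rect] applies;
    the integral over the square tends to 0 with its side, because g is bounded near [z0]. *)
Lemma goursat_but_one g (z0 : R[i]) a b c d : (forall z, ccont g z) ->
  a < complex.Re z0 < b -> c < complex.Im z0 < d ->
  (forall z, z != z0 -> exists D, cdiff g z D) ->
  rint g a b c d = 0.
Proof.
case: z0 => x0 y0 /= cg /andP[ax xb] /andP[cy yd] Hd.
have Hoff x y : (x != x0) || (y != y0) -> exists D, cdiff g (x +i* y) D.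
  by move=> H; apply: Hd; rewrite eq_complex /= negb_and.
apply/eqP; rewrite -cmod_eq0 eq_le cmod_ge0 andbT.
apply/ler_addgt0Pr => e e0; rewrite add0r.
have [d1 d10 H1] := ccont_bound (cg (x0 +i* y0)).
set M := cmod (g (x0 +i* y0)) + 1 in H1.
have M0 : 0 < M by rewrite /M; have := cmod_ge0 (g (x0 +i* y0)); lra.
(* The half-side of the square: the first four terms keep it strictly inside the rectangle, [d1 / 4]
   keeps it where [cmod (g z) <= M], and [e / (16 * M)] makes the bound 4 M (2 t + 2 t) at most
   e. *)
pose t := Num.min (Num.min ((x0 - a) / 2) ((b - x0) / 2))
  (Num.min (Num.min ((y0 - c) / 2) ((d - y0) / 2)) (Num.min (d1 / 4) (e / (16 * M)))).
have t0 : 0 < t by rewrite /t !lt_min !divr_gt0 ?mulr_gt0//; lra.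
have [t1 t2 t3] : [/\ t <= (x0 - a) / 2, t <= (b - x0) / 2 & t <= (y0 - c) / 2].
  by split; rewrite /t !ge_min lexx ?orbT.
have [t4 t5 t6] : [/\ t <= (d - y0) / 2, t <= d1 / 4 & t <= e / (16 * M)].
  by split; rewrite /t !ge_min lexx ?orbT.
rewrite (@rint_split_re R g a (x0 - t) b)//; [|lra|lra].
rewrite (@goursat_rect g a (x0 - t) c d)//; [|lra|lra|]; last first.
  by move=> x y xs ys; apply: Hoff; apply/orP; left; rewrite lt_eqF//; lra.
rewrite add0r (@rint_split_re R g (x0 - t) (x0 + t) b)//; [|lra|lra].
rewrite (@goursat_rect g (x0 + t) b c d)//; [|lra|lra|]; last first.
  by move=> x y xs ys; apply: Hoff; apply/orP; left; rewrite gt_eqF//; lra.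
rewrite addr0 (@rint_split_im R g _ _ c (y0 - t) d)//; [|lra|lra].
rewrite (@goursat_rect g _ _ c (y0 - t))//; [|lra|lra|]; last first.
  by move=> x y xs ys; apply: Hoff; apply/orP; right; rewrite lt_eqF//; lra.
rewrite add0r (@rint_split_im R g _ _ (y0 - t) (y0 + t) d)//; [|lra|lra].
rewrite (@goursat_rect g _ _ (y0 + t) d)//; [|lra|lra|]; last first.
  by move=> x y xs ys; apply: Hoff; apply/orP; right; rewrite gt_eqF//; lra.
rewrite addr0.
apply: le_trans (@rint_bound R g _ _ _ _ M cg _ _ _) _; [lra|lra| |].
  move=> x y xs ys; apply: H1.
  apply: le_lt_trans (cmod_le_ReIm _) _ => /=.
  have X : `|x - x0| <= t by rewrite ler_norml; apply/andP; split; lra.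
  have Y : `|y - y0| <= t by rewrite ler_norml; apply/andP; split; lra.
  lra.
move: t6; rewrite ler_pdivlMr ?mulr_gt0//; lra.
Qed.

End GoursatTheorem.

(** * Division of an entire function by a linear factor *)

Section CauchyDivision.
Context {R : realType}.
Implicit Types (f u : R[i] -> R[i]) (z w : R[i]).

Local Notation mu := (@lebesgue_measure R).

Lemma rcont_bounded (h : R -> R[i]) a b : rcont h -> a <= b ->
  exists2 M : R, 0 <= M & forall x, a <= x <= b -> cmod (h x) <= M.
Proof.
move=> /rcont_ReIm[h1 h2] ab.
have ch : {within `[a, b], continuous (fun x => `|complex.Re (h x)| + `|complex.Im (h x)|)}.
  apply: continuous_subspaceT => x; apply: cvgD; apply: cvg_norm; [exact: h1|exact: h2].
have [c _ Hc] := EVT_max ab ch.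
exists (`|complex.Re (h c)| + `|complex.Im (h c)|); first by rewrite addr_ge0.
move=> x xab; apply: le_trans (cmod_le_ReIm _) _; apply: Hc.
by rewrite in_itv.
Qed.

(* The four lines carrying the sides of [-1, 1]^2, not only the sides: the
   integrands below are then continuous along whole lines. *)
Definition on_lines z : Prop := `|complex.Re z| = 1 \/ `|complex.Im z| = 1.

Definition bcont f : Prop := forall z, on_lines z -> ccont f z.

Definition bint f : R[i] := rint f (- 1) 1 (- 1) 1.

Lemma on_lines_cmod z : on_lines z -> 1 <= cmod z.
Proof.
by case=> <-; [exact: Re_le_cmod|exact: Im_le_cmod].
Qed.

Lemma on_lines_sub z w : on_lines w -> cmod z < 1 / 2 -> 1 / 2 <= cmod (w - z).
Proof.
move=> /on_lines_cmod w1 z2; have := cmod_lipschitz w z; lra.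
Qed.

Lemma on_lines_neq z w : on_lines w -> cmod z < 1 / 2 -> w - z != 0.
Proof. by move=> wl z2; rewrite -cmod_gt0; have := on_lines_sub wl z2; lra. Qed.

Lemma bcont_rcont f : bcont f ->
  [/\ rcont (fun x => f (x +i* 1)), rcont (fun x => f (x +i* (-1))),
   rcont (fun x => f (1 +i* x)) & rcont (fun x => f ((-1) +i* x))].
Proof.
move=> bf; split.
- by apply: rcont_hline => x; apply: bf; right => /=; rewrite normr1.
- by apply: rcont_hline => x; apply: bf; right => /=; rewrite normrN normr1.
- by apply: rcont_vline => x; apply: bf; left => /=; rewrite normr1.
- by apply: rcont_vline => x; apply: bf; left => /=; rewrite normrN normr1.
Qed.

Lemma eq_bint f g : (forall z, on_lines z -> f z = g z) -> bint f = bint g.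
Proof.
move=> fg; rewrite /bint /rint; congr (_ + _ * _); congr cint; apply/funext => x;
  by rewrite !fg //; (try by left; rewrite /= ?normrN normr1); right; rewrite /= ?normrN normr1.
Qed.

Lemma bintD f g : bcont f -> bcont g ->
  bint (fun z => f z + g z) = bint f + bint g.
Proof.
move=> /bcont_rcont[f1 f2 f3 f4] /bcont_rcont[g1 g2 g3 g4]; rewrite /bint /rint.
have E1 := cintD (-1) 1 (rcontB f2 f1) (rcontB g2 g1).
have E2 := cintD (-1) 1 (rcontB f3 f4) (rcontB g3 g4).
rewrite addrACA -mulrDr -E1 -E2.
by congr (_ + _ * _); congr cint; apply/funext => x; rewrite opprD addrACA.
Qed.

Lemma bintZ (k : R[i]) f : bcont f -> bint (fun z => k * f z) = k * bint f.
Proof.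
move=> /bcont_rcont[f1 f2 f3 f4]; rewrite /bint /rint.
rewrite mulrDr mulrCA -(cintZ k (-1) 1 (rcontB f2 f1)) -(cintZ k (-1) 1 (rcontB f3 f4)).
by congr (_ + _ * _); congr cint; apply/funext => x; rewrite mulrBr.
Qed.

Lemma bint_bound f M : bcont f ->
  (forall z, on_lines z -> `|complex.Re z| <= 1 -> `|complex.Im z| <= 1 -> cmod (f z) <= M) ->
  cmod (bint f) <= 16 * M.
Proof.
move=> /bcont_rcont[f1 f2 f3 f4] fM; rewrite /bint /rint.
have le1 (x : R) : -1 <= x <= 1 -> `|x| <= 1 by rewrite ler_norml.
have B1 : cmod (cint (fun x => f (x +i* (-1)) - f (x +i* 1)) (-1) 1) <= 2 * (2 * M) * (1 - -1).
  apply: cint_bound; [exact: rcontB|lra|move=> x /le1 x1].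
  apply: le_trans (cmodB _ _) _.
  rewrite mulr_natl mulr2n lerD// fM//=; rewrite ?normrN ?normr1//;
  by right; rewrite /= ?normrN normr1.
have B2 : cmod (cint (fun x => f (1 +i* x) - f ((-1) +i* x)) (-1) 1) <= 2 * (2 * M) * (1 - -1).
  apply: cint_bound; [exact: rcontB|lra|move=> x /le1 x1].
  apply: le_trans (cmodB _ _) _.
  rewrite mulr_natl mulr2n lerD// fM//=; rewrite ?normrN ?normr1//;
  by left; rewrite /= ?normrN normr1.
apply: le_trans (cmodD _ _) _; rewrite cmodM cmodi mul1r; lra.
Qed.

Lemma bcont_bounded f : bcont f -> exists2 M : R, 0 <= M &
  forall z, on_lines z -> `|complex.Re z| <= 1 -> `|complex.Im z| <= 1 -> cmod (f z) <= M.
Proof.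
move=> /bcont_rcont[f1 f2 f3 f4].
have le11 : -1 <= 1 :> R by lra.
have [M1 M10 H1] := rcont_bounded f1 le11.
have [M2 M20 H2] := rcont_bounded f2 le11.
have [M3 M30 H3] := rcont_bounded f3 le11.
have [M4 M40 H4] := rcont_bounded f4 le11.
exists (M1 + M2 + M3 + M4); first lra.
case=> x y; rewrite /on_lines /= => -[] e1; rewrite !ler_norml => x1 y1.
  have := e1; case: (ler0P x) => x0 xe.
    have -> : x = -1 by lra.
    by have := H4 _ y1; lra.
  by rewrite xe; have := H3 _ y1; lra.
have := e1; case: (ler0P y) => x0 xe.
  have -> : y = -1 by lra.
  by have := H2 _ x1; lra.
by rewrite xe; have := H1 _ x1; lra.
Qed.

Lemma ccontM f g z : ccont f z -> ccont g z -> ccont (fun w => f w * g w) z.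
Proof.
move=> cf cg e e0.
have [d1 d10 H1] := ccont_bound cg.
have A0 : 0 < cmod (g z) + 1 by have := cmod_ge0 (g z); lra.
have B0 : 0 < cmod (f z) + 1 by have := cmod_ge0 (f z); lra.
have e2 : 0 < e / 2 by rewrite divr_gt0.
have [d2 d20 H2] := cf _ (divr_gt0 e2 A0).
have [d3 d30 H3] := cg _ (divr_gt0 e2 B0).
exists (Num.min d1 (Num.min d2 d3)); first by rewrite !lt_min d10 d20.
move=> w; rewrite !lt_min => /andP[/H1 w1 /andP[/H2 w2 /H3 w3]].
have -> : f w * g w - f z * g z = (f w - f z) * g w + f z * (g w - g z) by ring.
apply: le_trans (cmodD _ _) _; rewrite !cmodM.
move: w2 w3; rewrite !ler_pdivlMr// => w2 w3.
have := cmod_ge0 (f w - f z); have := cmod_ge0 (g w - g z).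
have := cmod_ge0 (f z); nra.
Qed.

Lemma ccontV f z : f z != 0 -> ccont f z -> ccont (fun w => (f w)^-1) z.
Proof.
move=> fz cf e e0; have m0 : 0 < cmod (f z) by rewrite cmod_gt0.
set m := cmod (f z) in m0.
have m2 : 0 < m / 2 by rewrite divr_gt0.
have e2 : 0 < e * m ^+ 2 / 2 by rewrite divr_gt0// mulr_gt0// exprn_gt0.
have [d1 d10 H1] := cf _ m2; have [d2 d20 H2] := cf _ e2.
exists (Num.min d1 d2); first by rewrite lt_min d10.
move=> w; rewrite lt_min => /andP[/H1 w1 /H2 w2].
have mw : m / 2 <= cmod (f w).
  have := cmod_lipschitz (f z) (f w); rewrite (cmod_distC (f z)) -/m; lra.
have fw : f w != 0 by rewrite -cmod_gt0; lra.
have -> : (f w)^-1 - (f z)^-1 = - ((f w - f z) / (f w * f z)) by field; rewrite fz fw.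
rewrite cmodN cmodM cmodV cmodM -/m ler_pdivrMr; last by rewrite mulr_gt0//; lra.
apply: le_trans w2 _; have := ler_wpM2l (mulr_ge0 (ltW e0) (ltW m0)) mw; lra.
Qed.

Lemma ccont_sub z w : ccont (fun x => x - w) z.
Proof. by apply: cdiff_ccont (cdiffD (cdiff_id z) (cdiff_cst (- w) z)). Qed.

Lemma bcont_kernel f z : bcont f -> cmod z < 1 / 2 -> bcont (fun x => f x / (x - z)).
Proof.
move=> bf z2 w wl; apply: ccontM; first exact: bf.
by apply: ccontV; [exact: on_lines_neq|exact: ccont_sub].
Qed.

(** From 1 / (x - h) = 1 / x + h / x^2 + h^2 / (x^2 (x - h)), the derivative at 0 is the integral of
    f / x^2. *)
Lemma cdiff_cauchy_integral f : bcont f ->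
  exists D, cdiff (fun z => bint (fun x => f x / (x - z))) 0 D.
Proof.
move=> bf.
have z0 : cmod (0 : R[i]) < 1 / 2 by rewrite cmod0; lra.
have b1 := bcont_kernel bf z0; have b2 := bcont_kernel b1 z0.
exists (bint (fun x => f x / (x - 0) / (x - 0))) => e e0.
have [M M0 HM] := bcont_bounded b2.
(* The remainder integral is at most 16 (2 M): [bint_bound] gives 16, and 1 / (x - h) is at most 2
   in modulus on the boundary. *)
have T0 : 0 < 32 * M + 1 by lra.
exists (Num.min (1 / 2) (e / (32 * M + 1))); first by rewrite lt_min !divr_gt0.
move=> h; rewrite lt_min => /andP[h2 he]; rewrite add0r.
have b3 := bcont_kernel b2 h2.
have E : bint (fun x => f x / (x - h)) =
  bint (fun x => f x / (x - 0)) + h * bint (fun x => f x / (x - 0) / (x - 0))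
  + h ^+ 2 * bint (fun x => f x / (x - 0) / (x - 0) / (x - h)).
  have Z1 := bintZ h b2; have Z2 := bintZ (h ^+ 2) b3.
  have bz (k : R[i]) g : bcont g -> bcont (fun x => k * g x).
    by move=> bg w /bg; apply: ccontM; apply: cdiff_ccont (cdiff_cst k w).
  rewrite -Z1 -Z2 -bintD//; last exact: bz.
  rewrite -bintD//; [|by move=> w wl; apply: ccontD; [exact: b1|exact: bz]|exact: bz].
  apply: eq_bint => x xl; have x1 := on_lines_neq xl h2.
  have := on_lines_neq xl z0; rewrite subr0 => x2.
  by field; rewrite x1.
rewrite E.
set I2 := bint (fun x => f x / (x - 0) / (x - 0)).
set I3 := bint (fun x => f x / (x - 0) / (x - 0) / (x - h)).
have -> (A : R[i]) : A + h * I2 + h ^+ 2 * I3 - A - I2 * h = h ^+ 2 * I3 by ring.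
have B : cmod I3 <= 16 * (2 * M).
  apply: bint_bound => // x xl xr xi.
  rewrite cmodM cmodV ler_pdivrMr; last by have := on_lines_sub xl h2; lra.
  apply: le_trans (HM _ xl xr xi) _.
  have := on_lines_sub xl h2; nra.
rewrite cmodM expr2 cmodM -mulrA mulrC ler_wpM2r ?cmod_ge0//.
move: he; rewrite ltr_pdivlMr// => he.
have := cmod_ge0 h; nra.
Qed.

Lemma bint_inv_neq0 : bint (fun x => 1 / (x - 0)) != 0.
Proof.
have D0 (x : R) : 1 + x ^+ 2 != 0 by rewrite gt_eqF// ltr_wpDr// sqr_ge0.
have ck (x : R) : {for x, continuous (fun x : R => 2 / (1 + x ^+ 2))}.
  apply: cvgM; first exact: cvg_cst.
  apply: cvgV; first exact: D0.
  by apply: cvgD; [exact: cvg_cst|exact: exprn_continuous].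
have E : bint (fun x => 1 / (x - 0)) = 2 * 'i * cint (fun x => (2 / (1 + x ^+ 2))%:C) (-1) 1.
  have i2 : 'i * 'i = -1 :> R[i] by rewrite -expr2 sqr_i.
  have DC (x : R) : 1 + x%:C ^+ 2 != 0 :> R[i].
    have -> : 1 + x%:C ^+ 2 = (1 + x ^+ 2)%:C :> R[i] by rewrite rmorphD rmorphXn rmorph1.
    by rewrite eq_complex /= eqxx andbT D0.
  have cC (x : R) : (2 / (1 + x ^+ 2))%:C = 2 / (1 + x%:C ^+ 2) :> R[i].
    by rewrite fmorph_div rmorph_nat; congr (_ / _); rewrite rmorphD rmorphXn rmorph1.
  have E1 : (fun x => 1 / ((x +i* (-1)) - 0) - 1 / ((x +i* 1) - 0)) =
     (fun x : R => 'i * (2 / (1 + x ^+ 2))%:C).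
    apply/funext => x; rewrite cC.
    have -> : x +i* (-1) = x%:C - 'i :> R[i].
      by apply/eqP; rewrite eq_complex /=; apply/andP; split; apply/eqP; ring.
    have -> : x +i* 1 = x%:C + 'i :> R[i].
      by apply/eqP; rewrite eq_complex /=; apply/andP; split; apply/eqP; ring.
    have P : (x%:C - 'i) * (x%:C + 'i) = 1 + x%:C ^+ 2 :> R[i].
      by rewrite mulrDr !mulrDl !mulNr i2; ring.
    have := DC x; rewrite -P mulf_eq0 negb_or => /andP[n1 n2].
    rewrite !subr0; field; rewrite n1 n2//.
  have E2 : (fun y => 1 / ((1 +i* y) - 0) - 1 / (((-1) +i* y) - 0)) =
     (fun x : R => (2 / (1 + x ^+ 2))%:C).
    apply/funext => x; rewrite cC.
    have -> : (1 +i* x) = 1 + 'i * x%:C :> R[i].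
      by apply/eqP; rewrite eq_complex /=; apply/andP; split; apply/eqP; ring.
    have -> : ((-1) +i* x) = - (1 - 'i * x%:C) :> R[i].
      by apply/eqP; rewrite eq_complex /=; apply/andP; split; apply/eqP; ring.
    have P : (1 + 'i * x%:C) * (1 - 'i * x%:C) = 1 + x%:C ^+ 2 :> R[i].
      have -> : (1 + 'i * x%:C) * (1 - 'i * x%:C) = 1 - ('i * 'i) * x%:C ^+ 2 :> R[i] by ring.
      by rewrite i2; ring.
    have := DC x; rewrite -P mulf_eq0 negb_or => /andP[n1 n2].
    rewrite !subr0 invrN mulrN opprK; field; rewrite n1 n2//.
  rewrite /bint /rint E1 E2 cintZ; first by ring.
  move=> x e e0.
  have /cvgrPdist_le/(_ _ e0)/nbhs_ballP[d d0 Hd] := ck x.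
  exists d => // y yx.
  rewrite [X in cmod X](_ : _ = (2 / (1 + y ^+ 2) - 2 / (1 + x ^+ 2))%:C).
    by rewrite cmodC distrC; apply: (Hd y); rewrite /ball /= distrC.
  by rewrite rmorphB.
rewrite E mulf_neq0 ?mulf_neq0 ?neq0Ci ?pnatr_eq0//.
rewrite eq_complex negb_and; apply/orP; left; rewrite /cint /= gt_eqF//.
have l11 : -1 <= 1 :> R by lra.
have : \int[mu]_(x in `[(-1), 1]) (1 : R) <= \int[mu]_(x in `[(-1), 1]) (2 / (1 + x ^+ 2)).
  apply: le_Rintegral => //.
  - by apply: continuous_integrable_itv => x; exact: cst_continuous.
  - by apply: continuous_integrable_itv; exact: ck.
  - move=> x /=; rewrite in_itv /= -ler_norml => x1.
    rewrite ler_pdivlMr ?mul1r; last by rewrite ltr_wpDr// sqr_ge0.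
    have : x ^+ 2 <= 1 by rewrite -real_normK ?num_real// expr_le1.
    lra.
have -> : \int[mu]_(x in `[(-1), 1]) (1 : R) = 2.
  by rewrite Rintegral_cst//; have /= := fine_lebesgue_itv l11; rewrite mul1r => ->; ring.
lra.
Qed.

Lemma cdiff_quotient u a z d : cdiff u z d -> z != a ->
  exists D, cdiff (fun w => u w / (w - a)) z D.
Proof.
move=> Hu za; eexists; apply: cdiffM Hu _.
apply: cdiffV; first by rewrite subr_eq0.
exact: cdiffD (cdiff_id z) (cdiff_cst (- a) z).
Qed.

Definition dquot u (a d : R[i]) w := if w == a then d else (u w - u a) / (w - a).

Lemma dquot_ccont u a d : cdiff u a d -> ccont (dquot u a d) a.
Proof.
move=> Hu e e0; have [dl dl0 H] := Hu e e0; exists dl => // w wa.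
rewrite /dquot eqxx; case: eqVneq => [_|na]; first by rewrite subrr cmod0 ltW.
have wa0 : w - a != 0 by rewrite subr_eq0.
have -> : (u w - u a) / (w - a) - d = (u w - u a - d * (w - a)) / (w - a) by field.
rewrite cmodM cmodV ler_pdivrMr ?cmod_gt0//.
by have := H _ wa; rewrite (addrC a) subrK.
Qed.

Lemma dquot_cdiff u a d z : entire u -> z != a -> exists D, cdiff (dquot u a d) z D.
Proof.
move=> /entireP/(_ z)[d0 Hd0] za.
have [D HD] := @cdiff_quotient (fun w => u w - u a) a z _
  (cdiffD Hd0 (cdiff_cst (- u a) z)) za.
exists D; apply: (cdiff_ext (r := cmod (z - a)) _ _ HD); first by rewrite cmod_gt0 subr_eq0.
move=> w; rewrite /dquot; case: eqVneq => // ->.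
by rewrite cmod_distC ltxx.
Qed.

(* Cauchy's integral formula, with the winding integral left unevaluated. *)
Lemma cauchy_formula u z : entire u -> cmod z < 1 / 2 ->
  bint (fun x => u x / (x - z)) = u z * bint (fun x => 1 / (x - z)).
Proof.
move=> Hu z2; have [d Hd] := (entireP u).1 Hu z.
have G0 : bint (dquot u z d) = 0.
  have /= zr := le_lt_trans (Re_le_cmod z) z2.
  have /= zi := le_lt_trans (Im_le_cmod z) z2.
  apply: (@goursat_but_one _ _ z).
  - move=> w; have [->|wz] := eqVneq w z; first exact: dquot_ccont.
    by have [D /cdiff_ccont] := dquot_cdiff d Hu wz.
  - by move: zr; rewrite ltr_norml => /andP[? ?]; apply/andP; split; lra.
  - by move: zi; rewrite ltr_norml => /andP[? ?]; apply/andP; split; lra.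
  - by move=> w; exact: dquot_cdiff.
have bu : bcont u by move=> w _; exact: entire_ccont.
have b1 : bcont (fun=> 1) by move=> w _; apply: cdiff_ccont (cdiff_cst 1 w).
have bk := bcont_kernel b1 z2.
have H : bint (dquot u z d) =
   bint (fun x => u x / (x - z)) + (- u z) * bint (fun x => 1 / (x - z)).
  rewrite -(bintZ _ bk) -bintD; first last.
  - move=> w wl; apply: ccontM; last exact: bk.
    by apply: cdiff_ccont (cdiff_cst _ w).
  - exact: bcont_kernel.
  apply: eq_bint => w wl; have wz := on_lines_neq wl z2.
  by rewrite /dquot -subr_eq0 (negbTE wz); field.
by move: H; rewrite G0 mulNr => /esym/eqP; rewrite subr_eq0 => /eqP.
Qed.

(** Near 0 the difference quotient equals [I1 / J], where [J] is the winding integral and [I1] is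
    the Cauchy integral of u1 / x. Both are differentiable at 0 and [J 0] is nonzero. The identity
    comes from u1 / (x - z) = u1 / x + z (u1 / x) / (x - z), the integral of u1 / x being 0 because
    u1 vanishes at 0. *)
Lemma dquot0_cdiff u d : entire u -> cdiff u 0 d -> exists D, cdiff (dquot u 0 d) 0 D.
Proof.
move=> Hu0 Hd0.
pose u1 := fun z => u z - u 0.
have Hu : entire u1.
  by apply/entireP => z; have [e He] := (entireP u).1 Hu0 z; eexists;
    apply: cdiffD He (cdiff_cst (- u 0) z).
have u10 : u1 0 = 0 by rewrite /u1 subrr.
have bu : bcont u1 by move=> w _; exact: entire_ccont.
have b1 : bcont (fun=> 1) by move=> w _; apply: cdiff_ccont (cdiff_cst 1 w).
have z0 : cmod (0 : R[i]) < 1 / 2 by rewrite cmod0; lra.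
have bv := bcont_kernel bu z0.
have [DI HI] := cdiff_cauchy_integral bv.
have [DJ HJ] := cdiff_cauchy_integral b1.
set I1 := fun z => bint _ in HI; set J := fun z => bint _ in HJ.
have J0 : J 0 != 0 by exact: bint_inv_neq0.
have key z : cmod z < 1 / 2 -> z != 0 -> dquot u 0 d z * J z = I1 z.
  move=> z2 nz.
  have C := cauchy_formula Hu z2; have C0 := cauchy_formula Hu z0.
  rewrite u10 mul0r in C0.
  have bvz := bcont_kernel bv z2.
  have : bint (fun x => u1 x / (x - z)) = bint (fun x => u1 x / (x - 0)) + z * I1 z.
    rewrite /I1 -(bintZ _ bvz) -bintD//; last first.
      move=> w wl; apply: ccontM; last exact: bvz.
      by apply: cdiff_ccont (cdiff_cst _ w).
    apply: eq_bint => w wl; have wz := on_lines_neq wl z2.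
    have := on_lines_neq wl z0; rewrite subr0 => w0.
    by field; rewrite wz.
  rewrite C0 add0r C -/(J z) => /(congr1 (fun x => z^-1 * x)).
  rewrite (mulrA _ z) mulVf// mul1r => <-.
  by rewrite /dquot (negbTE nz) -/(u1 z) subr0 mulrA (mulrC (u1 z)).
(* [key] leaves out z = 0; the identity passes to 0 by continuity of both sides there. *)
have cE : ccont (fun z => dquot u 0 d z * J z + (-1) * I1 z) 0.
  apply: ccontD; apply: ccontM.
  - exact: dquot_ccont.
  - exact: cdiff_ccont HJ.
  - by apply: cdiff_ccont (cdiff_cst _ _).
  - exact: cdiff_ccont HI.
have key0 : dquot u 0 d 0 * J 0 = I1 0.
  apply/eqP; rewrite -subr_eq0 -cmod_eq0 eq_le cmod_ge0 andbT.
  apply/ler_addgt0Pr => e e0; rewrite add0r.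
  have [dl dl0 H] := cE e e0.
  pose t := Num.min (dl / 2) (1 / 4).
  have t0 : 0 < t by rewrite lt_min !divr_gt0.
  have t1 : t <= dl / 2 by rewrite ge_min lexx.
  have t2 : t <= 1 / 4 by rewrite ge_min lexx orbT.
  have ct : cmod t%:C = t by rewrite cmodC gtr0_norm.
  have := H t%:C; rewrite subr0 ct key; first last.
  - by rewrite -cmod_gt0 ct.
  - by rewrite ct; lra.
  by rewrite !mulN1r subrr sub0r cmodN; apply; clear -t1 dl0; lra.
have m0 : 0 < cmod (J 0) / 2 by rewrite divr_gt0// cmod_gt0.
have [dl dl0 HJn] := cdiff_ccont HJ m0.
eexists; apply: (cdiff_ext (r := Num.min dl (1 / 2)) _ _ (cdiffM HI (cdiffV J0 HJ))).
  by rewrite lt_min dl0 divr_gt0.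
move=> w; rewrite lt_min => /andP[/HJn w1]; rewrite subr0 => w2.
have Jw : J w != 0.
  rewrite -cmod_gt0; have := cmod_lipschitz (J 0) (J w).
  rewrite (cmod_distC (J 0)); lra.
have <- : dquot u 0 d w * J w = I1 w.
  by have [->|] := eqVneq w 0; [exact: key0|exact: key].
by rewrite mulfK.
Qed.

Lemma entire_shift u b : entire u -> entire (fun z => u (z + b)).
Proof.
move=> Hu; apply/entireP => z.
have [d Hd] := (entireP u).1 Hu (1 * z + b).
exists (d * 1); have := cdiff_comp_affine Hd.
by congr cdiff; apply/funext => w; rewrite mul1r.
Qed.

(** Only the root needs Cauchy's formula: elsewhere the quotient rule applies. The translation moves
    the root to the centre of the square. *)
Lemma entire_div_root u a : entire u -> u a = 0 ->
  exists2 v, entire v & forall z, u z = (z - a) * v z.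
Proof.
move=> Hu ua; have Hu1 := entire_shift (b := a) Hu.
have [d Hd] := (entireP _).1 Hu1 0.
have [D HD] := dquot0_cdiff Hu1 Hd.
pose v := dquot (fun z => u (z + a)) 0 d.
exists (fun z => v (z - a)).
  apply: entire_shift; apply/entireP => z.
  by have [->|z0] := eqVneq z 0; [exists D|exact: dquot_cdiff].
move=> z; rewrite /v /dquot; have [/eqP|za] := eqVneq (z - a) 0.
  by rewrite subr_eq0 => /eqP ->; rewrite subrr mul0r.
by rewrite add0r subrK ua !subr0; field.
Qed.

End CauchyDivision.

(** * Exponential type and integrals over the line *)

Section ExponentialType.
Context {R : realType}.
Implicit Types (F G : R[i] -> R[i]) (tau : R).

(** The working form of the limsup: a logarithm bounded by t times the modulus is an exponential
    bound, and zeros of F satisfy both, because [lne 0] is -oo. *)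
Lemma exp_typeP tau F : exp_type_le tau F <->
  forall e, 0 < e -> exists M : R, forall z, M < cmod z ->
    cmod (F z) <= expR ((tau + e) * cmod z).
Proof.
pose f := (fun z : R[i]^o => ((cmod z)^-1)%:E * lne (cmod (F z))%:E)%E.
have fE (z : R[i]) (t : R) : 0 < cmod z ->
    (f z <= t%:E)%E <-> cmod (F z) <= expR (t * cmod z).
  move=> z0; rewrite /f; have [->|Fz0] := eqVneq (F z) 0.
    rewrite cmod0 le0_lneNy// gt0_muleNy ?lte_fin ?invr_gt0//; split=> _.
      exact: expR_ge0.
    exact: leNye.
  have Fz : 0 < cmod (F z) by rewrite cmod_gt0.
  rewrite lne_EFin// -EFinM lee_fin ler_pdivrMl//.
  by rewrite -{2}(lnK Fz) ler_expR mulrC.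
split.
- move=> H e e0.
  have : (limf_esup f (@cinfty_nbhs R) < (tau + e)%:E)%E.
    by apply: le_lt_trans H _; rewrite lte_fin ltrDl.
  rewrite limf_esupE => /ereal_inf_lt[_ [V [M HM] <-]] Vlt.
  exists (Num.max M 0) => z; rewrite gt_max => /andP[zM z0].
  apply/fE => //; apply: le_trans (ltW Vlt).
  by apply: ereal_sup_ubound; exists z => //; exact: HM.
- move=> H; apply/lee_addgt0Pr => e e0.
  have [M HM] := H e e0.
  (* The maximum with 0 excludes z = 0, where the inverse of the modulus takes its default value. *)
  pose V := [set z : R[i] | Num.max M 0 < cmod z].
  apply: (@le_trans _ _ (ereal_sup (f @` V))).
    rewrite limf_esupE; apply: ereal_inf_lbound; exists V => //.
    by exists (Num.max M 0).
  apply: ge_ereal_sup => _ [z Vz <-].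
  move: Vz; rewrite /V /= gt_max => /andP[zM z0].
  by rewrite -EFinD; apply/fE => //; exact: HM.
Qed.

(** For r >= 1 the left side is at most 2 |C| r, which the quadratic term (e r)^2 / 2 of the
    exponential exceeds once r >= 8 |C| / e^2. Factors of linear growth therefore leave the
    exponential type unchanged. *)
Lemma affine_le_expR (C e : R) : 0 < e -> exists2 M : R, 1 <= M &
  forall r, M < r -> C * (1 + r) <= expR (e * r).
Proof.
move=> e0; pose c := `|C|.
have c0 : 0 <= c by exact: normr_ge0.
have e20 : 0 < e ^+ 2 by rewrite exprn_gt0.
exists (1 + 8 * c / e ^+ 2).
  by rewrite lerDl divr_ge0// ?mulr_ge0// ltW.
move=> r rM.
have t0 : 0 <= 8 * c / e ^+ 2 by rewrite divr_ge0// ?mulr_ge0// ltW.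
have r1 : 1 <= r by lra.
have H1 : 8 * c <= r * e ^+ 2 by rewrite -ler_pdivrMr//; lra.
have H2 : C * (1 + r) <= c * (2 * r).
  have A : C * (1 + r) <= c * (1 + r) by rewrite ler_wpM2r ?ler_norm//; lra.
  apply: le_trans A _; rewrite ler_wpM2l//; lra.
have H3 : 1 + (e * r) ^+ 2 / 2 <= expR (e * r).
  have := @expR_ge1Dxn _ (e * r) 1; apply.
  by rewrite mulr_ge0// ltW//; lra.
apply: le_trans H2 _; apply: le_trans H3.
have := ler_wpM2r (_ : 0 <= r) H1; rewrite exprMn => /(_ _) H.
have {}H : 8 * c * r <= r * e ^+ 2 * r by apply: H; lra.
have : 0 <= c * r by rewrite mulr_ge0//; lra.
have -> : e ^+ 2 * r ^+ 2 = r * e ^+ 2 * r by ring.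
lra.
Qed.

Lemma exp_type_of_bound tau F (C M0 : R) :
  (forall z, M0 < cmod z -> cmod (F z) <= C * expR (tau * cmod z)) -> exp_type_le tau F.
Proof.
move=> H; apply/exp_typeP => e e0.
have [M M1 HM] := affine_le_expR `|C| e0.
exists (Num.max M0 M) => z; rewrite gt_max => /andP[z0 z1].
apply: le_trans (H _ z0) _; rewrite mulrDl expRD mulrC ler_wpM2l ?expR_ge0//.
apply: le_trans (HM _ z1); apply: le_trans (ler_norm _) _.
by rewrite ler_peMr//; lra.
Qed.

(** Half of the tolerance absorbs the linear factor. This one criterion covers scalar multiples,
    multiplication by z - a, and division by z - a, since |z - a| >= 1 far out. *)
Lemma exp_type_dom tau F G (C M0 : R) : 0 <= C -> exp_type_le tau G ->
  (forall z, M0 < cmod z -> cmod (F z) <= C * (1 + cmod z) * cmod (G z)) ->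
  exp_type_le tau F.
Proof.
move=> C0 /exp_typeP HG H; apply/exp_typeP => e e0.
have e2 : 0 < e / 2 by rewrite divr_gt0.
have [M HM] := HG _ e2; have [M1 M11 HM1] := affine_le_expR C e2.
exists (Num.max M0 (Num.max M M1)) => z; rewrite !gt_max => /and3P[z0 z1 z2].
apply: le_trans (H _ z0) _.
have -> : (tau + e) * cmod z = e / 2 * cmod z + (tau + e / 2) * cmod z by field.
rewrite expRD; apply: ler_pM; rewrite ?cmod_ge0//; last exact: HM.
- by rewrite mulr_ge0// addr_ge0// cmod_ge0.
- exact: HM1.
Qed.

Lemma exp_typeD tau F G : exp_type_le tau F -> exp_type_le tau G ->
  exp_type_le tau (fun z => F z + G z).
Proof.
move=> /exp_typeP HF /exp_typeP HG; apply/exp_typeP => e e0.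
have e2 : 0 < e / 2 by rewrite divr_gt0.
have [M HM] := HF _ e2; have [M1 HM1] := HG _ e2.
have [M2 M21 HM2] := affine_le_expR 1 e2.
exists (Num.max M (Num.max M1 M2)) => z; rewrite !gt_max => /and3P[z0 z1 z2].
apply: le_trans (cmodD _ _) _.
have -> : (tau + e) * cmod z = (tau + e / 2) * cmod z + e / 2 * cmod z by field.
rewrite expRD; have := HM _ z0; have := HM1 _ z1; have := HM2 _ z2; rewrite mul1r.
set E := expR ((tau + e / 2) * cmod z); have E0 : 0 <= E by exact: expR_ge0.
set E' := expR _ => a b c.
have : E * 2 <= E * E' by rewrite ler_wpM2l//; lra.
lra.
Qed.

Lemma exp_type_shift tau F (t : R[i]) : 0 <= tau -> exp_type_le tau F ->
  exp_type_le tau (fun z => F (z + t)).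
Proof.
move=> tau0 /exp_typeP HF; apply/exp_typeP => e e0.
have e2 : 0 < e / 2 by rewrite divr_gt0.
have [M HM] := HF _ e2.
(* The second term makes the extra exponent [(tau + e / 2) * cmod t] smaller than
   [e / 2 * cmod z]. *)
exists (Num.max (M + cmod t) ((tau + e / 2) * cmod t / (e / 2))) => z.
rewrite gt_max => /andP[z0]; rewrite ltr_pdivrMr// => z1.
have zt : cmod z <= cmod (z + t) + cmod t.
  by have := cmodB (z + t) t; rewrite addrK.
apply: le_trans (HM _ _) _; first lra.
rewrite ler_expR; have := cmodD z t.
move=> zt'; apply: le_trans (ler_wpM2l _ zt') _; first lra.
lra.
Qed.

Lemma entireD F G : entire F -> entire G -> entire (fun z => F z + G z).
Proof.
move=> /entireP HF /entireP HG; apply/entireP => z.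
have [a Ha] := HF z; have [b Hb] := HG z.
by eexists; exact: cdiffD Ha Hb.
Qed.

Lemma entireM F G : entire F -> entire G -> entire (fun z => F z * G z).
Proof.
move=> /entireP HF /entireP HG; apply/entireP => z.
have [a Ha] := HF z; have [b Hb] := HG z.
by eexists; exact: cdiffM Ha Hb.
Qed.

Lemma entire_const (c : R[i]) : entire (fun=> c).
Proof. by apply/entireP => z; eexists; exact: cdiff_cst. Qed.

Lemma entire_sub (a : R[i]) : entire (fun z => z - a).
Proof. by apply/entireP => z; eexists; exact: cdiffD (cdiff_id z) (cdiff_cst (- a) z). Qed.

Lemma entire_rcont F : entire F -> rcont (fun x : R => F x%:C).
Proof. by move=> HF; apply: (@rcont_hline _ F 0) => x; exact: entire_ccont. Qed.

End ExponentialType.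

(** * Integrals of real functions over the whole line *)

Section LineIntegral.
Context {R : realType}.
Implicit Types (f g : R -> R).

Local Notation mu := (@lebesgue_measure R).

Definition integ f : Prop := mu.-integrable setT (EFin \o f).

Lemma integ_measurable f : integ f -> measurable_fun setT f.
Proof. by move=> /integrableP[/measurable_EFinP]. Qed.

Lemma integD f g : integ f -> integ g -> integ (fun x => f x + g x).
Proof. by move=> hf hg; apply: (integrableD _ hf hg). Qed.

Lemma integZ (c : R) f : integ f -> integ (fun x => c * f x).
Proof. by move=> hf; apply: (integrableZl _ c hf). Qed.

Lemma integ_dom f g : measurable_fun setT f -> (forall x, `|f x| <= g x) ->
  integ g -> integ f.
Proof.
move=> mf fg; apply: le_integrable => //; first exact/measurable_EFinP.
by move=> x _ /=; rewrite lee_fin; apply: le_trans (fg x) (ler_norm _).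
Qed.

Lemma integ_ge0_lty f : measurable_fun setT f -> (forall x, 0 <= f x) ->
  (\int[mu]_x (f x)%:E < +oo)%E -> integ f.
Proof.
move=> mf f0 fy; apply/integrableP; split; first exact/measurable_EFinP.
rewrite (_ : (fun x => `|(EFin \o f) x|%E) = (fun x => (f x)%:E))//.
by apply/funext => x /=; rewrite ger0_norm.
Qed.

Lemma integ_lty f : integ f -> (\int[mu]_x (f x)%:E < +oo)%E.
Proof. by move=> hf; apply: (integrable_lty _ hf). Qed.

Lemma integ_EFin f : integ f -> (\int[mu]_x (f x)%:E)%E = (\int[mu]_x f x)%:E.
Proof.
move=> hf; rewrite /Rintegral fineK//; exact: (integrable_fin_num _ hf).
Qed.

Lemma integ_indic (a b : R) : integ ((\1_(`[a, b]%classic))).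
Proof.
apply: integ_ge0_lty; first exact: measurable_indic.
- by move=> x; rewrite indicE ler0n.
- have fin_itv : (mu `[a, b] < +oo)%E.
    by rewrite lebesgue_measure_itv /=; case: ifP => _; rewrite ?ltry// -EFinB ltry.
  by rewrite integral_indic// setIT.
Qed.

Lemma Rint_indic (a b : R) : a <= b -> \int[mu]_x (\1_(`[a, b]%classic)) x = b - a.
Proof.
move=> ab; rewrite /Rintegral integral_indic// setIT.
exact: (fine_lebesgue_itv ab).
Qed.

Lemma RintD f g : integ f -> integ g ->
  \int[mu]_x (f x + g x) = \int[mu]_x f x + \int[mu]_x g x.
Proof. by move=> hf hg; apply: RintegralD. Qed.

Lemma RintZ c f : integ f -> \int[mu]_x (c * f x) = c * \int[mu]_x f x.
Proof. by move=> hf; apply: RintegralZl. Qed.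

Lemma Rint_le f g : integ f -> integ g -> (forall x, f x <= g x) ->
  \int[mu]_x f x <= \int[mu]_x g x.
Proof. by move=> hf hg fg; apply: le_Rintegral. Qed.

Lemma Rint_ge0 f : (forall x, 0 <= f x) -> 0 <= \int[mu]_x f x.
Proof. by move=> f0; apply: Rintegral_ge0. Qed.

(** The pattern of all local-global estimates below: a bound [S] on a bounded interval and a
    comparison with [g] off it, combined in one inequality. *)
Lemma integ_indic_dom f g (S c a b : R) : measurable_fun setT f ->
  (forall x, 0 <= f x) -> integ g ->
  (forall x, f x <= S * (\1_(`[a, b]%classic)) x + c * g x) -> integ f.
Proof.
move=> mf f0 hg H.
apply: (integ_dom (g := fun x => S * (\1_(`[a, b]%classic)) x + c * g x) mf).
- by move=> x; rewrite ger0_norm//; exact: H.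
- by apply: integD; apply: integZ => //; exact: integ_indic.
Qed.

Lemma Rint_indic_dom f g (S c a b : R) : a <= b -> integ f -> integ g ->
  (forall x, f x <= S * (\1_(`[a, b]%classic)) x + c * g x) ->
  \int[mu]_x f x <= S * (b - a) + c * \int[mu]_x g x.
Proof.
move=> ab hf hg H.
have hi := integZ S (integ_indic a b); have hg' := integZ c hg.
by have := Rint_le hf (integD hi hg') H; rewrite RintD// !RintZ ?Rint_indic//;
  exact: integ_indic.
Qed.

Lemma Rint_shift f (t : R) : continuous f -> (forall x, 0 <= f x) ->
  (\int[mu]_x (f x)%:E = \int[mu]_x (f (x + t))%:E)%E.
Proof.
move=> cf f0.
have ds (x : R) : is_derive x 1 (fun y : R => y + t) 1.
  have := is_deriveD (is_derive_id x 1) (is_derive_cst t x 1).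
  by rewrite addr0.
have d1 : (fun y : R => y + t)^`()%classic = cst 1.
  by apply/funext => x; rewrite derive1E; apply: derive_val.
rewrite (@increasing_ge0_integration_by_substitutionT _ (fun y : R => y + t))//.
- by apply: eq_integral => x _; rewrite d1 /= mulr1.
- by move=> x y; rewrite ltrD2r.
- by rewrite d1 => x; exact: cst_continuous.
- by rewrite d1; apply: is_cvg_cst.
- by rewrite d1; apply: is_cvg_cst.
- apply/cvgrNyPle => A; exists (A - t); split; first exact: num_real.
  by move=> x; lra.
- apply/cvgryPge => A; exists (A - t); split; first exact: num_real.
  by move=> x; lra.
Qed.

End LineIntegral.

(** * Paley-Wiener spaces *)

Section PaleyWienerClosure.
Context {R : realType}.
Implicit Types (F G u v : R[i] -> R[i]) (tau a t : R).

Local Notation mu := (@lebesgue_measure R).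
Local Notation Re := (@complex.Re R).
Local Notation Im := (@complex.Im R).

Lemma rcont_sqr_continuous (f : R -> R[i]) : rcont f ->
  continuous (fun x => cmod (f x) ^+ 2).
Proof.
move=> /rcont_ReIm[f1 f2].
rewrite (_ : (fun x => _) = (fun x => Re (f x) ^+ 2 + Im (f x) ^+ 2)).
  move=> x; apply: cvgD.
    by apply: (@continuous_comp _ _ _ _ (fun y : R => y ^+ 2)); [exact: f1|exact: exprn_continuous].
  by apply: (@continuous_comp _ _ _ _ (fun y : R => y ^+ 2)); [exact: f2|exact: exprn_continuous].
by apply/funext => x; rewrite cmod_sqr.
Qed.

Definition line_sqr F (x : R) : R := cmod (F x%:C) ^+ 2.

Lemma line_sqr_ge0 F x : 0 <= line_sqr F x.
Proof. by rewrite /line_sqr exprn_ge0// cmod_ge0. Qed.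

Lemma line_sqr_continuous F : entire F -> continuous (line_sqr F).
Proof. by move=> /entire_rcont; exact: rcont_sqr_continuous. Qed.

Lemma line_sqr_measurable F : entire F -> measurable_fun setT (line_sqr F).
Proof. by move=> /line_sqr_continuous; exact: continuous_measurable_fun. Qed.

Lemma PW_integ tau F : PW tau F -> integ (line_sqr F).
Proof.
move=> [eF _ sF]; apply: integ_ge0_lty => //.
- exact: line_sqr_measurable.
- exact: line_sqr_ge0.
Qed.

Lemma PW_intro tau F : entire F -> exp_type_le tau F -> integ (line_sqr F) -> PW tau F.
Proof. by move=> eF tF iF; split => //; exact: integ_lty. Qed.

Lemma PW_entire tau F : PW tau F -> entire F. Proof. by case. Qed.

Lemma line_sqr_bounded F a b : entire F -> a <= b ->
  exists2 S, 0 <= S & forall x, a <= x <= b -> line_sqr F x <= S.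
Proof.
move=> /entire_rcont cF ab; have [M M0 HM] := rcont_bounded cF ab.
exists (M ^+ 2); first exact: sqr_ge0.
by move=> x /HM FM; rewrite /line_sqr ler_pXn2r// nnegrE cmod_ge0.
Qed.

Lemma PW_D tau F G : PW tau F -> PW tau G -> PW tau (fun z => F z + G z).
Proof.
move=> pF pG; have eD := entireD (PW_entire pF) (PW_entire pG).
apply: PW_intro => //.
  by case: pF pG => [_ tF _] [_ tG _]; exact: exp_typeD.
apply: (integ_dom (g := fun x => 2 * line_sqr F x + 2 * line_sqr G x)).
- exact: line_sqr_measurable.
- move=> x; rewrite ger0_norm ?line_sqr_ge0// /line_sqr.
  have := cmodD (F x%:C) (G x%:C); have := cmod_ge0 (F x%:C + G x%:C).
  have := cmod_ge0 (F x%:C); have := cmod_ge0 (G x%:C).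
  set p := cmod _; set q := cmod _; set r := cmod _ => p0 q0 r0 rpq.
  have : r ^+ 2 <= (q + p) ^+ 2 by rewrite ler_pXn2r ?nnegrE//; lra.
  have := sqr_ge0 (p - q); nra.
- by apply: integD; apply: integZ; [exact: PW_integ pF|exact: PW_integ pG].
Qed.

Lemma PW_Z tau (c : R[i]) F : PW tau F -> PW tau (fun z => c * F z).
Proof.
move=> pF; have eF := PW_entire pF.
apply: PW_intro; first exact: (entireM (@entire_const R c) eF).
  case: pF => _ tF _; apply: (exp_type_dom (C := cmod c) (M0 := 0) _ tF).
    exact: cmod_ge0.
  move=> z z0; rewrite cmodM -mulrA ler_wpM2l ?cmod_ge0//.
  by rewrite ler_peMl ?cmod_ge0//; lra.
rewrite (_ : line_sqr _ = fun x => cmod c ^+ 2 * line_sqr F x).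
  by apply: integZ; exact: PW_integ pF.
by apply/funext => x; rewrite /line_sqr cmodM exprMn.
Qed.

Lemma PW_B tau F G : PW tau F -> PW tau G -> PW tau (fun z => F z - G z).
Proof.
move=> pF /(PW_Z (-1)) pG; have := PW_D pF pG.
by congr PW; apply/funext => z; rewrite mulN1r.
Qed.

Lemma PW_shift tau t F : 0 <= tau -> PW tau F -> PW tau (fun z => F (z + t%:C)).
Proof.
move=> tau0 pF; have [eF tF sF] := pF.
have eS : entire (fun z => F (z + t%:C)) by exact: entire_shift.
split => //; first exact: exp_type_shift.
rewrite /sq_integrable_line; move: sF; rewrite /sq_integrable_line.
rewrite (Rint_shift t (line_sqr_continuous eF) (line_sqr_ge0 F)).
rewrite /line_sqr.
by under eq_integral do rewrite rmorphD.
Qed.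

Lemma int_line_sqr_shift F t : entire F ->
  \int[mu]_x line_sqr (fun z => F (z + t%:C)) x = \int[mu]_x line_sqr F x.
Proof.
move=> eF; rewrite /Rintegral (Rint_shift t (line_sqr_continuous eF) (line_sqr_ge0 F)).
by congr fine; apply: eq_integral => x _; rewrite /line_sqr rmorphD.
Qed.

Lemma PW_mulX tau a F : PW tau F -> integ (line_sqr (fun z => (z - a%:C) * F z)) ->
  PW tau (fun z => (z - a%:C) * F z).
Proof.
move=> pF iF; have [eF tF _] := pF.
apply: PW_intro iF; first exact: (entireM (@entire_sub R a%:C) eF).
apply: (exp_type_dom (C := 1 + `|a|) (M0 := 0) _ tF); first by rewrite addr_ge0.
move=> z z0; rewrite cmodM ler_wpM2r ?cmod_ge0//.
apply: le_trans (cmodB _ _) _; rewrite cmodC.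
have := mulr_ge0 (normr_ge0 a) (ltW z0); have := normr_ge0 a; lra.
Qed.

(** At distance at least 1 from the root the quotient is dominated by u; within distance 1 on the
    line it is bounded by continuity. *)
Lemma PW_div_root tau a u : PW tau u -> u a%:C = 0 ->
  exists2 v, PW tau v & forall z, u z = (z - a%:C) * v z.
Proof.
move=> pu ua; have [eu tu _] := pu.
have [v ev uv] := entire_div_root eu ua.
exists v => //; apply: PW_intro => //.
  apply: (exp_type_dom (C := 1) (M0 := `|a| + 1) _ tu) => // z za.
  have z1 : 1 <= cmod (z - a%:C).
    by have := cmod_lipschitz z a%:C; rewrite cmodC; lra.
  rewrite uv cmodM mul1r -[leLHS]mul1r; apply: ler_pM; rewrite ?cmod_ge0//.
    by have := cmod_ge0 z; lra.
  by rewrite -[leLHS]mul1r ler_wpM2r// cmod_ge0.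
have ab : a - 1 <= a + 1 by lra.
have [S S0 HS] := line_sqr_bounded ev ab.
apply: (integ_indic_dom (g := line_sqr u) (S := S) (c := 1) (a := a - 1) (b := a + 1)).
- exact: line_sqr_measurable.
- exact: line_sqr_ge0.
- exact: PW_integ pu.
move=> x; rewrite mul1r indicE mem_setE in_itv /=.
case: (boolP (_ && _)) => xa /=; first by rewrite mulr1; have := HS _ xa; have := line_sqr_ge0 u x; lra.
rewrite mulr0 add0r /line_sqr uv cmodM exprMn ler_peMl ?exprn_ge0 ?cmod_ge0//.
rewrite -rmorphB cmodC real_normK ?num_real//.
move: xa; rewrite negb_and -!ltNge => /orP[xa|xa]; nra.
Qed.

End PaleyWienerClosure.

(** * The complex exponential and an explicit function in the space *)

Section TestFunction.
Context {R : realType}.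
Local Notation mu := (@lebesgue_measure R).
Local Notation Re := (@complex.Re R).
Local Notation Im := (@complex.Im R).

Definition cexp (z : R[i]) : R[i] :=
  (expR (Re z) * cos (Im z)) +i* (expR (Re z) * sin (Im z)).

Lemma cexpD z w : cexp (z + w) = cexp z * cexp w.
Proof.
case: z w => a b [c d]; rewrite /cexp /=.
by apply/eqP; rewrite eq_complex /= expRD cosD sinD; apply/andP; split; apply/eqP; ring.
Qed.

Lemma cexp0 : cexp 0 = 1.
Proof. by rewrite /cexp /= expR0 cos0 sin0 mulr1 mulr0. Qed.

Lemma cmod_cexp z : cmod (cexp z) = expR (Re z).
Proof.
apply/eqP; rewrite -(@eqrXn2 _ 2) ?cmod_ge0 ?expR_ge0// cmod_sqr /=.
by rewrite !exprMn -mulrDr cos2Dsin2 mulr1.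
Qed.

Lemma is_derive_eps (f : R -> R) (x l : R) : is_derive x 1 f l ->
  forall e, 0 < e -> exists2 dl : R, 0 < dl &
    forall h, `|h| < dl -> `|f (x + h) - f x - l * h| <= e * `|h|.
Proof.
move=> [df <-] e e0; move: df => /derivableP[+ _].
move=> /cvgrPdist_le /(_ _ e0) /nbhs_ballP[d d0 Hd].
exists d => // h hd.
have [->|h0] := eqVneq h 0; first by rewrite addr0 mulr0 subr0 subrr normr0 mulr0.
have := Hd h; rewrite /ball /= sub0r normrN => /(_ hd h0).
rewrite /GRing.scale /= mulr1 (addrC h x) => H.
set D := derive f x 1 in H *.
have -> : f (x + h) - f x - D * h = - (h * (D - h^-1 * (f (x + h) - f x))) by field.
by rewrite normrN normrM mulrC ler_wpM2r.
Qed.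

Lemma cdiff_cexp0 : cdiff cexp 0 1.
Proof.
move=> e e0.
(* The real and imaginary parts of the remainder come out at most 4 t |h| and 5 t |h|. *)
pose t := Num.min 1 (e / 10).
have t0 : 0 < t by rewrite lt_min ltr01 divr_gt0.
have t1 : t <= 1 by rewrite ge_min lexx.
have te : 10 * t <= e.
  have : t <= e / 10 by rewrite ge_min lexx orbT.
  lra.
clearbody t.
have [d1 d10 H1] := is_derive_eps (is_derive_expR 0) t0.
have [d2 d20 H2] := is_derive_eps (is_derive_sin 0) t0.
have [d3 d30 H3] := is_derive_eps (is_derive_cos 0) t0.
exists (Num.min t (Num.min d1 (Num.min d2 d3))); first by rewrite !lt_min t0 d10 d20.
case=> x y; rewrite !lt_min => /and4P[h0 h1 h2 h3].
have xh : `|x| <= cmod (x +i* y) by exact: (Re_le_cmod (x +i* y)).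
have yh : `|y| <= cmod (x +i* y) by exact: (Im_le_cmod (x +i* y)).
have := H1 _ (le_lt_trans xh h1); rewrite add0r expR0 mul1r => {}H1.
have := H2 _ (le_lt_trans yh h2); rewrite add0r sin0 cos0 mul1r subr0 => {}H2.
have := H3 _ (le_lt_trans yh h3); rewrite add0r sin0 cos0 oppr0 mul0r subr0 => {}H3.
rewrite add0r mul1r cexp0; apply: le_trans (cmod_le_ReIm _) _.
move: h0 xh yh; set h := cmod (x +i* y) => h0 xh yh /=.
have h00 : 0 <= h by apply: le_trans (normr_ge0 x) xh.
set E := expR x in H1 *; set A := E - 1 - x in H1 *.
have E0 : 0 < E by exact: expR_gt0.
have xt : t * `|x| <= t * h by rewrite ler_wpM2l// ltW.
have yt : t * `|y| <= t * h by rewrite ler_wpM2l// ltW.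
have E1 : `|E - 1| <= 2 * t.
  have -> : E - 1 = A + x by rewrite /A; ring.
  apply: le_trans (ler_normD _ _) _.
  have : t * h <= 1 * h by rewrite ler_wpM2r.
  lra.
have E3 : E <= 3 by move: E1; rewrite ler_norml => /andP[_]; lra.
have R1 : `|E * cos y - 1 - x| <= 4 * (t * h).
  have -> : E * cos y - 1 - x = A + E * (cos y - 1) by rewrite /A; ring.
  apply: le_trans (ler_normD _ _) _; rewrite normrM (gtr0_norm E0).
  have : E * `|cos y - 1| <= 3 * (t * h).
    by apply: ler_pM => //; [exact: ltW|lra].
  lra.
have R2 : `|E * sin y - 0 - y| <= 5 * (t * h).
  have -> : E * sin y - 0 - y = E * (sin y - y) + (E - 1) * y by ring.
  apply: le_trans (ler_normD _ _) _; rewrite !normrM (gtr0_norm E0).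
  have : E * `|sin y - y| <= 3 * (t * h).
    by apply: ler_pM => //; [exact: ltW|lra].
  have : `|E - 1| * `|y| <= 2 * t * h by apply: ler_pM.
  lra.
have : 10 * t * h <= e * h by rewrite ler_wpM2r.
have := mulr_ge0 (ltW t0) h00.
lra.
Qed.

(** The functional equation carries the derivative at 0 to every point. *)
Lemma entire_cexp : entire cexp.
Proof.
apply/entireP => z; exists (cexp z * 1).
have := @cdiffM _ (fun=> cexp z) (fun w => cexp (1 * w + (- z))) z 0 (1 * 1)
   (cdiff_cst _ _) (@cdiff_comp_affine _ cexp 1 (- z) z 1 _).
rewrite mul1r subrr => /(_ cdiff_cexp0); rewrite !mul0r add0r mul1r.
congr cdiff; apply/funext => w; rewrite mul1r -cexpD.
by congr cexp; rewrite addrC subrK.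
Qed.

Lemma integ_oneDsqrV : integ (fun x : R => (1 + x ^+ 2)^-1).
Proof.
have c1 : continuous (fun x : R => (1 + x ^+ 2)^-1) by exact: continuous_oneDsqrV.
have m1 := continuous_measurable_fun c1.
have p1 (x : R) : 0 <= (1 + x ^+ 2)^-1 by rewrite invr_ge0 addr_ge0// sqr_ge0.
apply: integ_ge0_lty => //.
have I0 : (\int[mu]_(x in `[0%R, +oo[) ((1 + x ^+ 2)^-1)%:E < +oo)%E.
  have := @integral0y_oneDsqr R; rewrite /oneDsqr => ->; exact: ltry.
have mE : measurable_fun setT (EFin \o (fun x : R => (1 + x ^+ 2)^-1)).
  exact/measurable_EFinP.
have -> : [set: R] = `]-oo, 0%R[ `|` `[0%R, +oo[ by rewrite -set_itvNyy; rewrite (@itv_bndbnd_setU _ _ _ (BLeft 0)).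
rewrite ge0_integral_setU//=; first last.
- by apply/disj_setPS => x [] /=; rewrite !in_itv /= andbT => x0; rewrite leNgt x0.
- by move=> x _; rewrite lee_fin.
- exact: measurable_funTS mE.
apply: lte_add_pinfty => //.
apply: le_lt_trans (_ : (\int[mu]_(x in `]-oo, 0%R]) ((1 + x ^+ 2)^-1)%:E < +oo)%E).
  apply: ge0_subset_integral => //; first exact: measurable_funTS mE.
    by move=> x _; rewrite lee_fin.
  by move=> x /=; rewrite !in_itv /=; exact: ltW.
have := @ge0_integration_by_substitution0 R (EFin \o (fun x : R => (1 + x ^+ 2)^-1)) mE.
move=> /(_ (fun r => _)) H.
have {}H := H p1.
rewrite (_ : \int[mu]_(x in `]-oo, 0%R]) ((1 + x ^+ 2)^-1)%:E =
   \int[mu]_(x in `]-oo, 0%R]) ((1 + (- x)%R ^+ 2)^-1)%:E)%E; last first.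
  by apply: eq_integral => x _; rewrite sqrrN.
by rewrite -H.
Qed.

(** With c = tau / 2, u = e^(i c z) - 1 and g = u / z, the function is g^2, of type 2 c = tau. On
    the line u is bounded and |g|^2 is at most a multiple of 1 / (1 + x^2), so both g^2 and z g^2 =
    u g are square-integrable; this is why g is squared. *)
Lemma test_function_origin (tau : R) : 0 < tau ->
  exists F : R[i] -> R[i], [/\ PW tau F, PW tau (fun z => z * F z) & F 0 != 0].
Proof.
move=> tau0; pose c := tau / 2; have c0 : 0 < c by rewrite divr_gt0.
pose k : R[i] := 'i * c%:C.
pose u := fun z => cexp (k * z + 0) - 1.
have eu : entire u.
  apply: entireD; last exact: (@entire_const R (-1)).
  apply/entireP => z; have [d Hd] := (entireP _).1 entire_cexp (k * z + 0).
  by eexists; exact: cdiff_comp_affine Hd.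
have u0 : u 0 = 0 by rewrite /u mulr0 addr0 cexp0 subrr.
have uk : cdiff u 0 k.
  have H : cdiff cexp (k * 0 + 0) 1 by rewrite mulr0 addr0; exact: cdiff_cexp0.
  by have := cdiffD (cdiff_comp_affine H) (cdiff_cst (-1) 0); rewrite mul1r addr0.
have [g eg ug] := entire_div_root eu u0.
have {}ug z : u z = z * g z by rewrite ug subr0.
have ck : cmod k = c by rewrite /k cmodM cmodi mul1r cmodC gtr0_norm.
have g0 : g 0 != 0.
  (* The derivative of u at 0 is [k], of modulus c, so g is within c / 4 of [k] at small t; if g
     vanished at 0, it would also be within c / 4 of 0. *)
  apply/negP => /eqP g0.
  have c4 : 0 < c / 4 by rewrite divr_gt0.
  have [d1 d10 H1] := uk _ c4; have [d2 d20 H2] := entire_ccont 0 eg c4.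
  pose t := Num.min d1 d2 / 2.
  have m0 : 0 < Num.min d1 d2 by rewrite lt_min d10.
  have t0 : 0 < t by rewrite divr_gt0.
  have [t1 t2] : t < d1 /\ t < d2.
    have : t < Num.min d1 d2 by rewrite /t; lra.
    by rewrite lt_min => /andP.
  have ct : cmod t%:C = t by rewrite cmodC gtr0_norm.
  have := H1 t%:C; have := H2 t%:C; rewrite subr0 ct g0 subr0 => /(_ t2) G /(_ t1).
  rewrite add0r u0 subr0 ug (mulrC k) -mulrBr cmodM ct mulrC ler_pM2r//.
  move=> G2; have := cmod_lipschitz k (g t%:C); rewrite ck (cmod_distC k); lra.
have ubound z : cmod (u z) <= 2 * expR (c * cmod z).
  apply: le_trans (cmodB _ _) _; rewrite cmod1 cmod_cexp addr0.
  have E1 : 1 <= expR (c * cmod z).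
    by rewrite -expR0 ler_expR mulr_ge0 ?cmod_ge0// ltW.
  have : expR (Re (k * z)) <= expR (c * cmod z).
    rewrite ler_expR; apply: le_trans (ler_norm _) _; apply: le_trans (Re_le_cmod _) _.
    by rewrite cmodM ck.
  lra.
have uline (x : R) : cmod (u x%:C) <= 2.
  apply: le_trans (cmodB _ _) _; rewrite cmod1 cmod_cexp addr0.
  rewrite (_ : Re (k * x%:C) = 0) ?expR0//.
  by rewrite /k /=; ring.
have [S S0 HS] : exists2 S, 0 <= S & forall x, line_sqr g x <= S * (1 + x ^+ 2)^-1.
  have l11 : -1 <= 1 :> R by lra.
  have [S S0 HS] := line_sqr_bounded eg l11.
  (* On [-1, 1], 1 + x^2 <= 2 gives 2 S. Outside, 1 + x^2 <= 2 x^2 and x^2 |g|^2 = |u|^2 <= 4 give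
     8. *)
  exists (2 * S + 8); first lra.
  move=> x; have D0 : 0 < 1 + x ^+ 2 by rewrite ltr_wpDr// sqr_ge0.
  rewrite ler_pdivlMr//; have [x1|x1] := lerP (`|x|) 1.
    have : x ^+ 2 <= 1 by rewrite -real_normK ?num_real// expr_le1.
    move: x1; rewrite ler_norml => /HS gS x2.
    have : line_sqr g x * (1 + x ^+ 2) <= S * 2.
      by apply: ler_pM; rewrite ?line_sqr_ge0 ?addr_ge0 ?sqr_ge0//; lra.
    lra.
  have x2 : 1 <= x ^+ 2 by rewrite -real_normK ?num_real// expr_ge1// ltW.
  have ux : line_sqr u x <= 4.
    rewrite /line_sqr (_ : 4 = 2 ^+ 2); last by ring.
    by rewrite ler_pXn2r ?nnegrE ?cmod_ge0.
  have E : line_sqr u x = x ^+ 2 * line_sqr g x.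
    by rewrite /line_sqr ug cmodM exprMn cmodC real_normK ?num_real.
  have := line_sqr_ge0 g x; nra.
have ig : integ (line_sqr g).
  apply: (integ_dom (g := fun x => S * (1 + x ^+ 2)^-1)).
  - exact: line_sqr_measurable.
  - by move=> x; rewrite ger0_norm ?line_sqr_ge0//.
  - by apply: integZ; exact: integ_oneDsqrV.
have gS x : line_sqr g x <= S.
  apply: le_trans (HS x) _; rewrite ler_piMr// invf_le1.
    by rewrite lerDl sqr_ge0.
  by rewrite ltr_wpDr// sqr_ge0.
have gbound z : 1 < cmod z -> cmod (g z) <= cmod (u z).
  by move=> z1; rewrite ug cmodM ler_peMl ?cmod_ge0// ltW.
have cc z : tau * cmod z = c * cmod z + c * cmod z by rewrite /c; field.
have X z : expR (tau * cmod z) = expR (c * cmod z) ^+ 2 by rewrite cc expRD expr2.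
exists (fun z => g z * g z); split; last by rewrite mulf_neq0.
- apply: PW_intro; first exact: entireM.
    apply: (@exp_type_of_bound _ _ _ 4 1) => z z1; rewrite cmodM X.
    have := le_trans (gbound _ z1) (ubound z); have := cmod_ge0 (g z).
    have := expR_ge0 (c * cmod z); nra.
  apply: (integ_dom (g := fun x => S * line_sqr g x)).
  + by apply: line_sqr_measurable; exact: entireM.
  + move=> x; rewrite ger0_norm ?line_sqr_ge0// {1}/line_sqr cmodM exprMn.
    by rewrite ler_wpM2r ?exprn_ge0 ?cmod_ge0//; exact: gS.
  + exact: integZ.
- rewrite (_ : (fun z => _) = (fun z => u z * g z)); last first.
    by apply/funext => z; rewrite ug mulrA.
  apply: PW_intro; first exact: entireM.
    apply: (@exp_type_of_bound _ _ _ 4 1) => z z1; rewrite cmodM X.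
    have := le_trans (gbound _ z1) (ubound z); have := cmod_ge0 (g z).
    have := ubound z; have := cmod_ge0 (u z).
    have := expR_ge0 (c * cmod z); nra.
  apply: (integ_dom (g := fun x => 4 * line_sqr g x)).
  + by apply: line_sqr_measurable; exact: entireM.
  + move=> x; rewrite ger0_norm ?line_sqr_ge0// {1}/line_sqr cmodM exprMn.
    rewrite ler_wpM2r ?exprn_ge0 ?cmod_ge0//.
    have := uline x; have := cmod_ge0 (u x%:C); nra.
  + exact: integZ.
Qed.

Lemma test_function (tau p : R) : 0 < tau ->
  exists F : R[i] -> R[i],
    [/\ PW tau F, PW tau (fun z => (z - p%:C) * F z) & F p%:C != 0].
Proof.
move=> tau0; have [F [pF pzF F0]] := test_function_origin tau0.
exists (fun z => F (z + (- p)%:C)); split.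
- by apply: PW_shift => //; exact: ltW.
- have := PW_shift (- p) (ltW tau0) pzF.
  by congr PW; apply/funext => z; rewrite rmorphN.
- by rewrite -rmorphD subrr.
Qed.

End TestFunction.

(** * The weights *)

Section Weight.
Context {R : realType}.
Local Notation mu := (@lebesgue_measure R).

Lemma sin_le_id (y : R) : 0 <= y -> `|sin y| <= y.
Proof.
rewrite le_eqVlt => /orP[/eqP <-|y0]; first by rewrite sin0 normr0.
have [c _] := MVT y0 (fun x _ => is_derive_sin x)
  (continuous_subspaceT (@continuous_sin R)).
rewrite sin0 !subr0 => ->; rewrite normrM (gtr0_norm y0).
by rewrite ler_piMl ?cos_max// ltW.
Qed.

Lemma sinc2pi_norm (x : R) : x != 0 ->
  `|sinc2pi x| = `|sin (2 * pi * `|x|)| / (2 * pi * `|x|).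
Proof.
move=> x0; rewrite /sinc2pi (negbTE x0) normrM normfV.
have p0 : 0 < 2 * pi :> R by rewrite mulr_gt0// pi_gt0.
rewrite [`|2 * pi * x|]normrM (gtr0_norm p0); congr (_ / _).
by case: (ler0P x) => // _; rewrite mulrN sinN normrN.
Qed.

Lemma sinc2pi_le1 (x : R) : `|sinc2pi x| <= 1.
Proof.
have [->|x0] := eqVneq x 0; first by rewrite /sinc2pi eqxx normr1.
have y0 : 0 < 2 * pi * `|x| by rewrite !mulr_gt0 ?pi_gt0 ?normr_gt0.
by rewrite sinc2pi_norm// ler_pdivrMr// mul1r sin_le_id// ltW.
Qed.

(** Put y = 2 pi |x|. For y >= 2 the quotient is at most 1/2. For smaller y, sin y = 2 sin (y/2) cos
    (y/2) bounds it by cos (y/2), which stays below 1 away from 0. *)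
Lemma sinc2pi_lt1 (dl : R) : 0 < dl -> exists2 c : R, 0 < c &
  forall x, dl <= `|x| -> `|sinc2pi x| <= 1 - c.
Proof.
move=> dl0.
have p0 : 0 < 2 * pi :> R by rewrite mulr_gt0// pi_gt0.
pose eta : R := Num.min (2 * pi * dl) 1.
have e0 : 0 < eta by rewrite lt_min mulr_gt0// ltr01.
have e1 : eta <= 1 by rewrite ge_min lexx orbT.
have e2 : eta <= 2 * pi * dl by rewrite ge_min lexx.
clearbody eta.
have pi2 := pi_ge2 R.
have c1 : cos (eta / 2) < 1.
  have i1 : eta / 2 \in `[0, pi] by rewrite in_itv /=; apply/andP; split; lra.
  have i2 : (0 : R) \in `[0, pi] by rewrite in_itv /=; apply/andP; split; lra.
  by rewrite -[ltRHS]cos0 (ltr_cos i2 i1) divr_gt0.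
exists (Num.min (1 / 2) (1 - cos (eta / 2))); first by rewrite lt_min divr_gt0//= subr_gt0.
move=> x dx.
have x0 : x != 0 by rewrite -normr_gt0; lra.
rewrite sinc2pi_norm//.
set y := 2 * pi * `|x|.
have ye : eta <= y by apply: le_trans e2 _; rewrite /y ler_wpM2l// ltW.
have y0 : 0 < y by lra.
rewrite ler_pdivrMr//.
have m1 : Num.min (1 / 2) (1 - cos (eta / 2)) <= 1 / 2 by rewrite ge_min lexx.
have m2 : Num.min (1 / 2) (1 - cos (eta / 2)) <= 1 - cos (eta / 2) by rewrite ge_min lexx orbT.
set c := Num.min _ _ in m1 m2 *.
have [y2|y2] := lerP 2 y.
  have := sin_max y; nra.
have -> : y = y / 2 + y / 2 by field.
rewrite sinD.
have -> : sin (y / 2) * cos (y / 2) + cos (y / 2) * sin (y / 2) = 2 * (sin (y / 2) * cos (y / 2)) by ring.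
have cy0 : 0 < cos (y / 2) by apply: cos_gt0_pihalf; apply/andP; split; lra.
have cye : cos (y / 2) <= cos (eta / 2).
  have i1 : eta / 2 \in `[0, pi] by rewrite in_itv /=; apply/andP; split; lra.
  have i2 : y / 2 \in `[0, pi] by rewrite in_itv /=; apply/andP; split; lra.
  by rewrite leNgt (ltr_cos i2 i1) -leNgt; lra.
rewrite !normrM (gtr0_norm cy0) ger0_norm//.
have sy : `|sin (y / 2)| <= y / 2 by apply: sin_le_id; lra.
have := normr_ge0 (sin (y / 2)); nra.
Qed.

Lemma sinc2pi_measurable : measurable_fun setT (@sinc2pi R).
Proof.
apply: measurable_fun_if => //.
- exact: measurable_fun_eqr.
- rewrite setTI (_ : _ @^-1` _ = [set x | x != 0]); last first.
    by apply/seteqP; split=> x /=; [move=> ->|move/negbTE].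
  apply: open_continuous_measurable_fun.
    exact: open_neq.
  move=> x; rewrite inE /= => x0.
  have c2 : {for x, continuous (fun y : R => 2 * pi * y)}.
    by apply: cvgM; [exact: cvg_cst|exact: cvg_id].
  apply: cvgM.
    by apply: (@continuous_comp _ _ _ (fun y : R => 2 * pi * y) sin) => //; exact: continuous_sin.
  apply: cvgV => //.
  by rewrite mulf_neq0// mulf_neq0// ?pnatr_eq0// gt_eqF// pi_gt0.
Qed.

Lemma W_dens_bounds G (x : R) : 1 - `|sinc2pi x| <= W_dens G x <= 2.
Proof.
have := sinc2pi_le1 x; have := ler_norm (sinc2pi x); have := ler_norm (- sinc2pi x).
rewrite normrN => *; case: G => /=; apply/andP; split; lra.
Qed.

Lemma W_dens_ge0 G (x : R) : 0 <= W_dens G x.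
Proof. by have /andP[+ _] := W_dens_bounds G x; apply: le_trans; rewrite subr_ge0 sinc2pi_le1. Qed.

Lemma W_dens_le2 G (x : R) : W_dens G x <= 2.
Proof. by have /andP[] := W_dens_bounds G x. Qed.

(** The densities for [GSp] and [GSOodd] vanish at 0, so a positive lower bound exists only off a
    neighbourhood of 0; the neighbourhood is treated by the sup bound. *)
Lemma W_dens_lower G (dl : R) : 0 < dl -> exists2 c : R, 0 < c &
  forall x, dl <= `|x| -> c <= W_dens G x.
Proof.
move=> /sinc2pi_lt1[c c0 Hc]; exists c => // x /Hc sx.
by have /andP[H _] := W_dens_bounds G x; lra.
Qed.

Lemma W_dens_measurable G : measurable_fun setT (@W_dens R G).
Proof.
have ms := sinc2pi_measurable.
case: G => /=; try exact: measurable_cst.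
- by apply: measurable_funB => //; exact: measurable_cst.
- by apply: measurable_funD => //; exact: measurable_cst.
- by apply: measurable_funB => //; exact: measurable_cst.
Qed.

Lemma W_mass_ge0 G : 0 <= W_mass R G.
Proof. by case: G => //=; rewrite invr_ge0. Qed.

(** The mass is a parameter: [W_mass R G] gives the weighted integral of the problem, and 0 isolates
    its density part. *)
Definition Lf (G : symmetry_group) (m : R) (g : R -> R) : R :=
  \int[mu]_x (g x * W_dens G x) + m * g 0.

Context (G : symmetry_group).
Implicit Types (m : R) (f g : R -> R).

Lemma integ_mulW f : integ f -> integ (fun x => f x * W_dens G x).
Proof.
move=> hf; apply: (integ_dom (g := fun x => 2 * `|f x|)).
- by apply: measurable_funM; [exact: integ_measurable|exact: W_dens_measurable].
- move=> x; rewrite normrM (ger0_norm (W_dens_ge0 G x)) mulrC ler_wpM2r//.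
  exact: W_dens_le2.
- by apply: integZ; exact: (integrable_abse hf).
Qed.

Lemma W_intE g : integ g -> W_int G g = (Lf G (W_mass R G) g)%:E.
Proof. by move=> hg; rewrite /W_int integ_EFin//; exact: integ_mulW. Qed.

Lemma LfD m f g : integ f -> integ g -> Lf G m (fun x => f x + g x) = Lf G m f + Lf G m g.
Proof.
move=> hf hg; rewrite /Lf.
have -> : (fun x => (f x + g x) * W_dens G x) =
  (fun x => f x * W_dens G x + g x * W_dens G x) by apply/funext => x; rewrite mulrDl.
by rewrite RintD; [ring|exact: integ_mulW|exact: integ_mulW].
Qed.

Lemma LfZ m (c : R) f : integ f -> Lf G m (fun x => c * f x) = c * Lf G m f.
Proof.
move=> hf; rewrite /Lf.
have -> : (fun x => c * f x * W_dens G x) =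
  (fun x => c * (f x * W_dens G x)) by apply/funext => x; rewrite mulrA.
by rewrite RintZ; [ring|exact: integ_mulW].
Qed.

Lemma Lf_ge0 m f : 0 <= m -> (forall x, 0 <= f x) -> 0 <= Lf G m f.
Proof.
move=> m0 f0; rewrite addr_ge0 ?mulr_ge0//; apply: Rint_ge0 => x.
by rewrite mulr_ge0// W_dens_ge0.
Qed.

Lemma Lf_mass m f : Lf G m f = Lf G 0 f + m * f 0.
Proof. by rewrite /Lf mul0r addr0. Qed.

Lemma Lf0_le f : integ f -> (forall x, 0 <= f x) -> Lf G 0 f <= 2 * \int[mu]_x f x.
Proof.
move=> hf f0; rewrite /Lf mul0r addr0 -RintZ//; apply: Rint_le.
- exact: integ_mulW.
- exact: integZ.
- by move=> x; rewrite mulrC ler_wpM2r// W_dens_le2.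
Qed.

End Weight.

(** Stated for numbers because it serves twice: for the weighted inner product, and for the
    semidefinite form of the extremal problem. *)
Lemma quadratic_discriminant (R : realType) (a b c : R) :
  (forall s t : R, 0 <= s ^+ 2 * a + 2 * s * t * b + t ^+ 2 * c) -> b ^+ 2 <= a * c.
Proof.
move=> H.
have a0 : 0 <= a by have := H 1 0; lra.
have [a00|an0] := eqVneq a 0.
  have [->|b0] := eqVneq b 0; first by rewrite a00 mul0r expr0n.
  (* When a = 0 the form at t = 1 is 2 s b + c, and this s makes it -1. *)
  have := H (- (c + 1) / (2 * b)) 1.
  rewrite a00 (_ : _ + _ = -1); first by lra.
  by field.
have {an0}a0 : 0 < a by rewrite lt_def an0.
have := H (- b) a.
have -> : (- b) ^+ 2 * a + 2 * (- b) * a * b + a ^+ 2 * c = a * (a * c - b ^+ 2) by ring.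
by rewrite pmulr_rge0// subr_ge0.
Qed.

(** * The weighted inner product and its kernel *)

Section WeightedInnerProduct.
Context {R : realType} (G : symmetry_group) (tau : R).
Implicit Types (F H u v : R[i] -> R[i]) (m : R).

Local Notation mu := (@lebesgue_measure R).
Local Notation Re := (@complex.Re R).
Local Notation Im := (@complex.Im R).

Definition rdot F H (x : R) : R := Re (F x%:C * (H x%:C)^*%C).
Definition idot F H (x : R) : R := Im (F x%:C * (H x%:C)^*%C).

Lemma rdotE F H x : rdot F H x = Re (F x%:C) * Re (H x%:C) + Im (F x%:C) * Im (H x%:C).
Proof. by rewrite /rdot; case: (F _) => ? ?; case: (H _) => ? ? /=; ring. Qed.

Lemma idotE F H x : idot F H x = Im (F x%:C) * Re (H x%:C) - Re (F x%:C) * Im (H x%:C).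
Proof. by rewrite /idot; case: (F _) => ? ?; case: (H _) => ? ? /=; ring. Qed.

Lemma rdotC F H : rdot F H = rdot H F.
Proof. by apply/funext => x; rewrite !rdotE; ring. Qed.

Lemma rdotii F : rdot F F = line_sqr F.
Proof. by apply/funext => x; rewrite rdotE /line_sqr cmod_sqr !expr2. Qed.

Lemma idotii F : idot F F = fun=> 0.
Proof. by apply/funext => x; rewrite idotE; ring. Qed.

Lemma rdotMl (c : R[i]) F H x :
  rdot (fun z => c * F z) H x = Re c * rdot F H x - Im c * idot F H x.
Proof.
by rewrite !rdotE idotE; case: (F _) => ? ?; case: (H _) => ? ?; case: c => ? ? /=; ring.
Qed.

Lemma rdotMr (c : R[i]) F H x :
  rdot F (fun z => c * H z) x = Re c * rdot F H x + Im c * idot F H x.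
Proof.
by rewrite !rdotE idotE; case: (F _) => ? ?; case: (H _) => ? ?; case: c => ? ? /=; ring.
Qed.

Lemma rdotDl F1 F2 H x : rdot (fun z => F1 z + F2 z) H x = rdot F1 H x + rdot F2 H x.
Proof.
by rewrite !rdotE; case: (F1 _) => ? ?; case: (F2 _) => ? ?; case: (H _) => ? ? /=; ring.
Qed.

(** Every estimate for imaginary parts thus follows from the one for real parts, applied to i H. *)
Lemma idot_rdot F H : idot F H = rdot F (fun z => 'i * H z).
Proof. by apply/funext => x; rewrite rdotMr /=; ring. Qed.

Lemma rdot_continuous F H : entire F -> entire H -> continuous (rdot F H).
Proof.
move=> /entire_rcont/rcont_ReIm[f1 f2] /entire_rcont/rcont_ReIm[h1 h2].
have -> : rdot F H = fun x => Re (F x%:C) * Re (H x%:C) + Im (F x%:C) * Im (H x%:C).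
  by apply/funext => x; rewrite rdotE.
move=> x; apply: cvgD; apply: cvgM; [exact: f1|exact: h1|exact: f2|exact: h2].
Qed.

Lemma integ_rdot F H : PW tau F -> PW tau H -> integ (rdot F H).
Proof.
move=> pF pH; apply: (integ_dom (g := fun x => line_sqr F x + line_sqr H x)).
- apply: continuous_measurable_fun; apply: rdot_continuous; [exact: PW_entire pF|exact: PW_entire pH].
- move=> x; rewrite rdotE /line_sqr !cmod_sqr.
  move: (Re _) (Im _) (Re _) (Im _) => a b c d.
  have := sqr_ge0 (a - c); have := sqr_ge0 (a + c); have := sqr_ge0 (b - d).
  have := sqr_ge0 (b + d); have := sqr_ge0 a; have := sqr_ge0 b; have := sqr_ge0 c.
  have := sqr_ge0 d => *.
  rewrite ler_norml; apply/andP; split; nra.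
- by apply: integD; [exact: PW_integ pF|exact: PW_integ pH].
Qed.

Lemma integ_idot F H : PW tau F -> PW tau H -> integ (idot F H).
Proof. by move=> pF pH; rewrite idot_rdot; apply: integ_rdot => //; exact: PW_Z. Qed.

Lemma Lf_rdotDl m F1 F2 H : PW tau F1 -> PW tau F2 -> PW tau H ->
  Lf G m (rdot (fun z => F1 z + F2 z) H) = Lf G m (rdot F1 H) + Lf G m (rdot F2 H).
Proof.
move=> p1 p2 pH; rewrite -LfD; try exact: integ_rdot.
by congr Lf; apply/funext => x; rewrite rdotDl.
Qed.

Lemma Lf_rdotZ m (c : R) F H : PW tau F -> PW tau H ->
  Lf G m (rdot (fun z => c%:C * F z) H) = c * Lf G m (rdot F H).
Proof.
move=> pF pH; rewrite -LfZ; last exact: integ_rdot.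
by congr Lf; apply/funext => x; rewrite rdotMl /=; ring.
Qed.

Lemma Lf_rdotC m F H : Lf G m (rdot F H) = Lf G m (rdot H F).
Proof. by rewrite rdotC. Qed.

Lemma Lf_sqr_ge0 m F : 0 <= m -> 0 <= Lf G m (line_sqr F).
Proof. by move=> m0; apply: Lf_ge0 => // x; exact: line_sqr_ge0. Qed.

Lemma Lf_sqr_comb m F H (s t : R) : PW tau F -> PW tau H ->
  Lf G m (line_sqr (fun z => s%:C * F z + t%:C * H z)) =
  s ^+ 2 * Lf G m (line_sqr F) + 2 * s * t * Lf G m (rdot F H) + t ^+ 2 * Lf G m (line_sqr H).
Proof.
move=> pF pH; have psF := PW_Z s%:C pF; have ptH := PW_Z t%:C pH.
have pS := PW_D psF ptH.
rewrite -rdotii Lf_rdotDl// !Lf_rdotZ//.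
rewrite (Lf_rdotC _ F) (Lf_rdotC _ H) !Lf_rdotDl// !Lf_rdotZ// !rdotii (Lf_rdotC _ H F).
by ring.
Qed.

Lemma cauchy_schwarz m F H : 0 <= m -> PW tau F -> PW tau H ->
  Lf G m (rdot F H) ^+ 2 <= Lf G m (line_sqr F) * Lf G m (line_sqr H).
Proof.
move=> m0 pF pH; apply: quadratic_discriminant => s t.
by rewrite -Lf_sqr_comb//; exact: Lf_sqr_ge0.
Qed.

Lemma line_sqrZ (c : R[i]) F : line_sqr (fun z => c * F z) = fun x => cmod c ^+ 2 * line_sqr F x.
Proof. by apply/funext => x; rewrite /line_sqr cmodM exprMn. Qed.

Lemma line_sqri F : line_sqr (fun z => 'i * F z) = line_sqr F.
Proof. by apply/funext => x; rewrite line_sqrZ cmodi expr1n mul1r. Qed.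

Lemma Lf_sqrD_le m F H : 0 <= m -> PW tau F -> PW tau H ->
  Lf G m (line_sqr (fun z => F z + H z)) <=
  2 * Lf G m (line_sqr F) + 2 * Lf G m (line_sqr H).
Proof.
move=> m0 pF pH.
have E := Lf_sqr_comb m 1 1 pF pH; have E' := Lf_sqr_comb m 1 (-1) pF pH.
have E0 := Lf_sqr_ge0 (fun z => 1%:C * F z + (-1)%:C * H z) m0.
have -> : (fun z => F z + H z) = (fun z => 1%:C * F z + 1%:C * H z).
  by apply/funext => z; rewrite !mul1r.
rewrite E; rewrite E' in E0; lra.
Qed.

End WeightedInnerProduct.

(** * Norm comparisons and bounded division, drawn from the kernel *)

Section ReproducingKernel.
Context {R : realType} (G : symmetry_group) (tau : R) (tau_gt0 : 0 < tau).
Context (K : R[i] -> R[i] -> R[i]) (hK : is_reproducing_kernel G tau K).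
Implicit Types (F H u v : R[i] -> R[i]).

Local Notation mu := (@lebesgue_measure R).
Local Notation Re := (@complex.Re R).
Local Notation Im := (@complex.Im R).
Local Notation m := (W_mass R G).
Local Notation L := (Lf G m).
Local Notation N F := (Lf G m (line_sqr F)).

Lemma PW_kernel w : PW tau (K w). Proof. by case: (hK w). Qed.

Lemma kernel_eval F w : PW tau F -> F w = L (rdot F (K w)) +i* L (idot F (K w)).
Proof.
move=> pF; have pK := PW_kernel w; have [_ /(_ F pF) ->] := hK w.
rewrite /W_inner; congr (_ +i* _).
- by rewrite (W_intE G (integ_rdot pF pK)).
- by rewrite (W_intE G (integ_idot pF pK)).
Qed.

(** The right-hand side is the real part of conj(c) F(w). *)
Lemma kernel_dot F w (c : R[i]) : PW tau F ->
  L (rdot F (fun z => c * K w z)) = Re c * Re (F w) + Im c * Im (F w).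
Proof.
move=> pF; have pK := PW_kernel w; rewrite (kernel_eval w pF) /=.
have iR := integ_rdot pF pK; have iI := integ_idot pF pK.
rewrite -!LfZ// -LfD; [|exact: integZ|exact: integZ].
by congr Lf; apply/funext => x; rewrite rdotMr.
Qed.

Lemma N_ge0 F : 0 <= N F.
Proof. by apply: Lf_sqr_ge0; exact: W_mass_ge0. Qed.

(** Cauchy-Schwarz is applied to the real and imaginary parts separately, hence the factor 2. *)
Lemma eval_bound F w : PW tau F -> cmod (F w) ^+ 2 <= 2 * (N F * N (K w)).
Proof.
move=> pF; have pK := PW_kernel w; rewrite cmod_sqr {1 2}(kernel_eval w pF) /=.
have C1 := cauchy_schwarz G (W_mass_ge0 G) pF pK.
have C2 := cauchy_schwarz G (W_mass_ge0 G) pF (PW_Z 'i pK).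
rewrite -idot_rdot line_sqri in C2; lra.
Qed.

Lemma N_eq0 F : PW tau F -> N F = 0 -> F = cst 0.
Proof.
move=> pF N0; apply/funext => w /=.
have := eval_bound w pF; rewrite N0 mul0r mulr0 => H.
apply/eqP; rewrite -cmod_eq0 -sqrf_eq0 eq_le H sqr_ge0//.
Qed.

Lemma kernel_diag w : K w w = (N (K w))%:C.
Proof.
rewrite (kernel_eval w (PW_kernel w)) rdotii idotii; congr (_ +i* _).
rewrite /Lf mulr0 addr0 (_ : (fun x => _) = fun=> 0); last by apply/funext => x; rewrite mul0r.
by rewrite Rintegral_cst// mul0r.
Qed.

Lemma kernel_diag_gt0 (p : R) : 0 < N (K p%:C).
Proof.
rewrite lt_def N_ge0 andbT; apply/eqP => N0.
have [F [pF _ /negP[]]] := test_function p tau_gt0.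
have := eval_bound p%:C pF; rewrite N0 !mulr0 => H.
by rewrite -cmod_eq0 -sqrf_eq0 eq_le H sqr_ge0.
Qed.

(** With k = K(0, 0), the reproducing property gives k = I + m k^2, where I is the density part of
    the norm of K_0. Since k > 0 makes I positive, k (1 - m k) > 0. *)
Lemma kernel_mass_lt1 : 0 < Lf G 0 (line_sqr (K 0)) /\ 0 < 1 - m * N (K 0).
Proof.
have k0 : 0 < N (K 0) := kernel_diag_gt0 0.
have kE := kernel_diag 0.
have pK := PW_kernel 0; have eK := PW_entire pK.
set k := N (K 0) in k0 kE *.
have sq0 : line_sqr (K 0) 0 = k ^+ 2.
  by rewrite /line_sqr kE cmodC gtr0_norm.
have I0 : 0 < Lf G 0 (line_sqr (K 0)).
  have k2 : 0 < k ^+ 2 / 2 by rewrite divr_gt0// exprn_gt0.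
  have /cvgrPdist_le/(_ _ k2)/nbhs_ballP[d d0 Hd] := line_sqr_continuous eK (x := 0).
  have d4 : 0 < d / 4 by rewrite divr_gt0.
  have [c c0 Hc] := W_dens_lower G d4.
  have C0 : 0 < k ^+ 2 / 2 * c by rewrite mulr_gt0.
  have ab : d / 4 <= d / 2 by lra.
  (* On [d/4, d/2] the point is near enough to 0 for |K_0|^2 >= k^2 / 2, and far enough from it for
     the density to be at least c. *)
  apply: lt_le_trans (_ : k ^+ 2 / 2 * c * (d / 4) <= _); first by rewrite mulr_gt0.
  rewrite /Lf mul0r addr0 (_ : d / 4 = d / 2 - d / 4); last by field.
  rewrite -(Rint_indic ab) -RintZ; last exact: integ_indic.
  apply: Rint_le.
  - by apply: integZ; exact: integ_indic.
  - by apply: integ_mulW; exact: PW_integ pK.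
  move=> x; rewrite indicE mem_setE in_itv /=.
  case: (boolP (_ && _)) => [/andP[x1 x2]|_]; last first.
    by rewrite mulr0 mulr_ge0 ?line_sqr_ge0 ?W_dens_ge0.
  have x0 : 0 < x by lra.
  rewrite mulr1; apply: ler_pM; [exact: ltW|exact: ltW| |].
    have := Hd x; rewrite /ball /= sub0r normrN gtr0_norm// => /(_ _).
    have xd : x < d by lra.
    move=> /(_ xd); rewrite sq0 ler_norml => /andP[_]; lra.
  by apply: Hc; rewrite gtr0_norm.
split => //.
have E : k = Lf G 0 (line_sqr (K 0)) + m * k ^+ 2 by rewrite -sq0 /k Lf_mass.
have : 0 < k * (1 - m * k) by nra.
by rewrite pmulr_rgt0.
Qed.

(* Evaluation at t is evaluation at 0 of the translate F (z + t), whose L2 norm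
   does not depend on t; the point mass contributes the factor 1 - m K(0,0). *)
Lemma sup_bound : exists2 C : R, 0 < C & forall F t, PW tau F ->
  line_sqr F t <= C * \int[mu]_x line_sqr F x.
Proof.
have [I0 mk] := kernel_mass_lt1.
set I := Lf G 0 _ in I0; set k := N (K 0) in mk.
have pK := PW_kernel 0.
exists (4 * I / (1 - m * k) ^+ 2); first by rewrite divr_gt0 ?mulr_gt0 ?exprn_gt0.
move=> F t pF; pose Ft := fun z => F (z + t%:C).
have pFt : PW tau Ft by apply: PW_shift => //; exact: ltW.
have Ft0 : Ft 0 = F t%:C by rewrite /Ft add0r.
have kE : K 0 0 = k%:C := kernel_diag 0.
have E := kernel_eval 0 pFt; rewrite Ft0 in E.
have ER : Re (F t%:C) * (1 - m * k) = Lf G 0 (rdot Ft (K 0)).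
  have := congr1 Re E; rewrite /= (Lf_mass _ m) {1}rdotE -[0%:C]/(0 : R[i]) kE Ft0 /=; lra.
have EI : Im (F t%:C) * (1 - m * k) = Lf G 0 (idot Ft (K 0)).
  have := congr1 Im E; rewrite /= (Lf_mass _ m) {1}idotE -[0%:C]/(0 : R[i]) kE Ft0 /=; lra.
(* The mass is 0 here: the density part of the norm of [Ft] is at most twice the
   translation-invariant L2 integral, while the point mass would bring back F(t). *)
have C1 := cauchy_schwarz G (lexx 0) pFt pK.
have C2 := cauchy_schwarz G (lexx 0) pFt (PW_Z 'i pK).
rewrite -idot_rdot line_sqri in C2.
rewrite -ER exprMn in C1; rewrite -EI exprMn in C2.
have iF := PW_integ pFt.
have NF := Lf0_le G iF (line_sqr_ge0 Ft).
rewrite (int_line_sqr_shift t (PW_entire pF)) in NF.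
rewrite mulrAC ler_pdivlMr ?exprn_gt0// /line_sqr cmod_sqr.
rewrite -/(line_sqr (K 0)) -/I in C1 C2.
have := ler_wpM2r (ltW I0) NF.
rewrite /line_sqr in C1 C2 NF *; lra.
Qed.

(** On [-d, d], where the density may vanish, the sup bound gives at most 2 d C I = I / 2, which is
    absorbed into the left side; off it the density is bounded below. *)
Lemma int_le_N : exists2 C : R, 0 < C & forall F, PW tau F ->
  \int[mu]_x line_sqr F x <= C * N F.
Proof.
have [C C0 HC] := sup_bound.
pose d := 1 / (4 * C).
have d0 : 0 < d by rewrite divr_gt0// mulr_gt0.
have [c c0 Hc] := W_dens_lower G d0.
exists (2 / c); first by rewrite divr_gt0.
move=> F pF; have iF := PW_integ pF.
set I := \int[mu]_x _.
have ab : - d <= d by lra.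
have H : I <= C * I * (d - - d) + c^-1 * \int[mu]_x (line_sqr F x * W_dens G x).
  apply: Rint_indic_dom => //; first exact: integ_mulW.
  move=> x; rewrite indicE mem_setE in_itv /= -ler_norml.
  case: (lerP `|x| d) => xd /=.
    rewrite mulr1; have := HC F x pF; rewrite -/I.
    have : 0 <= c^-1 * (line_sqr F x * W_dens G x).
      by rewrite mulr_ge0 ?invr_ge0 ?(ltW c0)// mulr_ge0 ?line_sqr_ge0 ?W_dens_ge0.
    lra.
  rewrite mulr0 add0r ler_pdivlMl// mulrC ler_wpM2l ?line_sqr_ge0//.
  by apply: Hc; exact: ltW.
have NE : \int[mu]_x (line_sqr F x * W_dens G x) <= N F.
  by rewrite /Lf lerDl mulr_ge0 ?W_mass_ge0 ?line_sqr_ge0.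
have dE : C * I * (d - - d) = I / 2 by rewrite /d; field; rewrite gt_eqF.
rewrite dE in H.
have c1 : 0 < c^-1 by rewrite invr_gt0.
have := ler_wpM2l (ltW c1) NE; lra.
Qed.

Lemma N_le_int : exists2 C : R, 0 < C & forall F, PW tau F ->
  N F <= C * \int[mu]_x line_sqr F x.
Proof.
have [C C0 HC] := sup_bound.
exists (2 + m * C); first by rewrite ltr_wpDr// mulr_ge0 ?W_mass_ge0// ltW.
move=> F pF; rewrite Lf_mass.
have := Lf0_le G (PW_integ pF) (line_sqr_ge0 F).
have := ler_wpM2l (W_mass_ge0 G) (HC F 0 pF); lra.
Qed.

(* The sup bound applied to the quotient v itself absorbs the mass of v near a. *)
Lemma bounded_division (a : R) : exists2 C : R, 0 < C & forall v,
  PW tau v -> PW tau (fun z => (z - a%:C) * v z) ->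
  N v <= C * N (fun z => (z - a%:C) * v z).
Proof.
have [C C0 HC] := sup_bound; have [C1 C10 HC1] := int_le_N.
have [C2 C20 HC2] := N_le_int.
pose d := 1 / (4 * C).
have d0 : 0 < d by rewrite divr_gt0// mulr_gt0.
have d2 : 0 < d ^+ 2 by rewrite exprn_gt0.
exists (C2 * (2 / d ^+ 2 * C1)); first by rewrite !mulr_gt0// invr_gt0.
move=> v pv; set u := fun z => _ => pu.
have iv := PW_integ pv; have iu := PW_integ pu.
set I := \int[mu]_x line_sqr v x.
have ab : a - d <= a + d by lra.
have H : I <= C * I * (a + d - (a - d)) + (d ^+ 2)^-1 * \int[mu]_x line_sqr u x.
  apply: Rint_indic_dom => // x; rewrite indicE mem_setE in_itv /= -ler_distl.
  have E : line_sqr u x = (x - a) ^+ 2 * line_sqr v x.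
    rewrite /line_sqr /u cmodM exprMn -[x%:C - a%:C]rmorphB cmodC real_normK//.
    exact: num_real.
  case: (lerP `|x - a| d) => xd /=.
    rewrite mulr1; have := HC v x pv; rewrite -/I.
    have : 0 <= (d ^+ 2)^-1 * line_sqr u x.
      by rewrite mulr_ge0 ?line_sqr_ge0// invr_ge0 ltW.
    lra.
  rewrite mulr0 add0r ler_pdivlMl// E ler_wpM2r ?line_sqr_ge0//.
  by rewrite -[leRHS]real_normK ?num_real// ler_pXn2r ?nnegrE//; exact: ltW.
have dE : C * I * (a + d - (a - d)) = I / 2 by rewrite /d; field; rewrite gt_eqF.
rewrite dE in H.
have H1 := HC1 u pu; have H2 := HC2 v pv; rewrite -/I in H2.
have i2 : 0 < (d ^+ 2)^-1 by rewrite invr_gt0.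
apply: le_trans H2 _; rewrite -mulrA ler_wpM2l// ?(ltW C20)//.
have := ler_wpM2l (ltW i2) H1; lra.
Qed.

End ReproducingKernel.

(** * The extremal problem *)

Section Extremal.
Context {R : realType} (G : symmetry_group) (tau : R) (tau_gt0 : 0 < tau).
Context (K : R[i] -> R[i] -> R[i]) (hK : is_reproducing_kernel G tau K).
Context (alpha : R).
Implicit Types (f g : R[i] -> R[i]).

Local Notation mu := (@lebesgue_measure R).
Local Notation Re := (@complex.Re R).
Local Notation Im := (@complex.Im R).
Local Notation m := (W_mass R G).
Local Notation L := (Lf G m).
Local Notation N F := (Lf G m (line_sqr F)).

Definition mulX (a : R) f := fun z => (z - a%:C) * f z.

(** The functions with finite numerator. By [dom_mulX] the centre [alpha] may be replaced by any
    real number. *)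
Definition dom f := PW tau f /\ PW tau (mulX alpha f).

Lemma dom_mulX a f : PW tau f -> PW tau (mulX a f) -> forall b, PW tau (mulX b f).
Proof.
move=> pf pa b; have := PW_D pa (PW_Z (a - b)%:C pf).
by congr PW; apply/funext => z; rewrite /mulX rmorphB; ring.
Qed.

Lemma dom_PW f b : dom f -> PW tau (mulX b f).
Proof. by case=> pf /(dom_mulX pf). Qed.

Lemma rdot_mulX a b f g x : rdot (mulX a f) (mulX b g) x = (x - a) * (x - b) * rdot f g x.
Proof.
rewrite !rdotE /mulX -![x%:C - _%:C]rmorphB.
by case: (f _) => ? ?; case: (g _) => ? ? /=; ring.
Qed.

Lemma dot_shifted xi f g : dom f -> dom g ->
  L (rdot (mulX (alpha - xi) f) (mulX (alpha + xi) g)) =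
  L (rdot (mulX alpha f) (mulX alpha g)) - xi ^+ 2 * L (rdot f g).
Proof.
move=> df dg; have [pf pf'] := df; have [pg pg'] := dg.
rewrite -mulNr -LfZ; last exact: integ_rdot pf pg.
rewrite -LfD; [|exact: integ_rdot pf' pg'|by apply: integZ; exact: integ_rdot pf pg].
by congr Lf; apply/funext => x; rewrite !rdot_mulX; ring.
Qed.

Lemma kernel_dot1 F w : PW tau F -> L (rdot F (K w)) = Re (F w).
Proof.
move=> pF; have := kernel_dot hK w 1 pF; rewrite /= mul1r mul0r addr0 => <-.
by congr Lf; congr rdot; apply/funext => z; rewrite mul1r.
Qed.

Lemma zero_attained xi : K (alpha + xi)%:C (alpha - xi)%:C = 0 ->
  exists f, [/\ dom f, f <> cst 0 & N (mulX alpha f) = xi ^+ 2 * N f].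
Proof.
set p := alpha + xi; set q := alpha - xi => Kpq.
have pK := PW_kernel hK p%:C.
have [v pv Kv] := PW_div_root pK Kpq.
have qv : mulX q v = K p%:C by apply/funext => z; rewrite /mulX -Kv.
have dv : dom v by split => //; apply: (@dom_mulX q) => //; rewrite qv.
exists v; split => //.
  move=> v0; have := kernel_diag_gt0 tau_gt0 hK p.
  rewrite -qv v0 (_ : mulX q (cst 0) = cst 0); last first.
    by apply/funext => z; rewrite /mulX mulr0.
  rewrite (_ : line_sqr (cst 0) = fun=> 0); last first.
    by apply/funext => x; rewrite /line_sqr cmod0 expr0n.
  rewrite /Lf (_ : (fun x => _) = fun=> 0); last by apply/funext => x; rewrite mul0r.
  by rewrite Rintegral_cst// mul0r mulr0 addr0 ltxx.
have := dot_shifted xi dv dv; rewrite -/p -/q qv rdotC kernel_dot1; last exact: dom_PW.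
rewrite {1}/mulX subrr mul0r !rdotii => /esym/eqP; rewrite subr_eq0 => /eqP -> //.
Qed.

(** By [dot_shifted] the pairing on the left is the polarization of the form N((x - alpha) f) - xi^2
    N f, which is nonnegative by hypothesis but possibly degenerate. *)
Lemma Q_cauchy_schwarz xi f g : (forall f, dom f -> xi ^+ 2 * N f <= N (mulX alpha f)) ->
  dom f -> dom g ->
  L (rdot (mulX (alpha - xi) f) (mulX (alpha + xi) g)) ^+ 2 <=
  (N (mulX alpha f) - xi ^+ 2 * N f) * (N (mulX alpha g) - xi ^+ 2 * N g).
Proof.
move=> Hxi df dg; have [pf pf'] := df; have [pg pg'] := dg.
rewrite dot_shifted//; apply: quadratic_discriminant => s t.
have pc := PW_D (PW_Z s%:C pf) (PW_Z t%:C pg).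
have E : mulX alpha (fun z => s%:C * f z + t%:C * g z) =
   (fun z => s%:C * mulX alpha f z + t%:C * mulX alpha g z).
  by apply/funext => z; rewrite /mulX; ring.
have dc : dom (fun z => s%:C * f z + t%:C * g z).
  by split => //; rewrite E; apply: PW_D; apply: PW_Z.
have := Hxi _ dc; rewrite E (Lf_sqr_comb G m s t pf pg) (Lf_sqr_comb G m s t pf' pg').
lra.
Qed.

(* If (f, g) -> <(x-q) f, (x-p) g> is positive and K(p, q) <> 0, the form is
   coercive: the component of (x-q) f orthogonal to K_p is controlled by the
   Cauchy-Schwarz inequality for the form, and the K_p component by evaluating
   at the zero q. *)
Lemma coercive xi : 0 <= xi ->
  (forall f, dom f -> xi ^+ 2 * N f <= N (mulX alpha f)) ->
  K (alpha + xi)%:C (alpha - xi)%:C <> 0 ->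
  exists2 C : R, 0 < C & forall f, dom f -> N f <= C * (N (mulX alpha f) - xi ^+ 2 * N f).
Proof.
move=> xi0 Hxi; set p := alpha + xi; set q := alpha - xi => /eqP Kpq.
have [Cp Cp0 HCp] := bounded_division tau_gt0 hK p.
have [Cq Cq0 HCq] := bounded_division tau_gt0 hK q.
have pK := PW_kernel hK p%:C.
have k0 := kernel_diag_gt0 tau_gt0 hK p.
have kE := kernel_diag hK p%:C.
have kq0 := N_ge0 G (K q%:C).
set k := N (K p%:C) in k0 kE; set kq := N (K q%:C) in kq0.
have kap0 : 0 < cmod (K p%:C q%:C) by rewrite cmod_gt0.
set kap := cmod _ in kap0.
have kap2 : 0 < kap ^+ 2 by rewrite exprn_gt0.
(* From (x - alpha) g = h' + xi g and N g <= Cp N h'. *)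
pose C1 := 2 + 2 * xi ^+ 2 * Cp.
have C10 : 0 < C1 by rewrite ltr_wpDr// !mulr_ge0 ?sqr_ge0// ltW.
(* From N (h' + c K_p) <= 2 N h' + 2 |c|^2 k and |c|^2 <= 2 kq N h' / kap^2. *)
pose C2 := 2 + 4 * kq * k / kap ^+ 2.
have C20 : 0 < C2.
  by rewrite ltr_wpDr// divr_ge0 ?(ltW kap2)// mulr_ge0 ?(ltW k0)// mulr_ge0.
exists (Cq * (C2 * C1)); first by rewrite !mulr_gt0.
move=> f df; set e := N (mulX alpha f) - _.
have e0 : 0 <= e by rewrite subr_ge0 Hxi.
have ph := dom_PW q df.
pose c := mulX q f p%:C / k%:C.
have pcK := PW_Z c pK.
pose h' := fun z => mulX q f z - c * K p%:C z.
have ph' : PW tau h' by exact: PW_B.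
have kn0 : k%:C != 0 :> R[i] by rewrite eq_complex /= eqxx andbT gt_eqF.
have h'p : h' p%:C = 0 by rewrite /h' kE /c divfK// subrr.
have [g pg hg] := PW_div_root ph' h'p.
have gE : mulX p g = h' by apply/funext => z; rewrite /mulX -hg.
have dg : dom g by split => //; apply: (@dom_mulX p) => //; rewrite gE.
have hE : mulX q f = fun z => h' z + c * K p%:C z.
  by apply/funext => z; rewrite /h' subrK.
(* Since h' vanishes at p it is orthogonal to K_p, so only h' survives in the pairing. *)
have Qfg : L (rdot (mulX q f) (mulX p g)) = N h'.
  rewrite gE hE (Lf_rdotDl G m ph' pcK ph') rdotii (rdotC (fun z => c * _)).
  by rewrite (kernel_dot hK p%:C c ph') h'p /= !mulr0 !addr0.
have CS := Q_cauchy_schwarz Hxi df dg; rewrite -/p -/q Qfg -/e in CS.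
have Ng : N (mulX alpha g) <= C1 * N h'.
  have E : mulX alpha g = fun z => h' z + xi%:C * g z.
    apply/funext => z; rewrite -gE /mulX /p rmorphD; ring.
  rewrite E; apply: le_trans (Lf_sqrD_le G (W_mass_ge0 G) ph' (PW_Z xi%:C pg)) _.
  rewrite line_sqrZ LfZ; last exact: PW_integ pg.
  rewrite cmodC ger0_norm//.
  have := HCp g pg; rewrite -[fun z => _]/(mulX p g) gE => /(_ ph') Hg.
  have := ler_wpM2l (sqr_ge0 xi) Hg; rewrite /C1; lra.
have Nh'0 : 0 <= N h' by exact: N_ge0.
have Nh' : N h' <= C1 * e.
  (* Cauchy-Schwarz gives (N h')^2 <= e C1 N h', to be divided by N h'. *)
  have [->|Nn0] := eqVneq (N h') 0; first by rewrite mulr_ge0// ltW.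
  have {}Nh'0 : 0 < N h' by rewrite lt_def Nn0.
  rewrite -(ler_pM2r Nh'0) -expr2; apply: le_trans CS _.
  rewrite (_ : C1 * e * N h' = e * (C1 * N h')); last by ring.
  apply: ler_wpM2l => //; apply: le_trans Ng.
  by rewrite gerBl mulr_ge0 ?sqr_ge0// N_ge0.
have cb : cmod c ^+ 2 * kap ^+ 2 <= 2 * (N h' * kq).
  have := eval_bound hK q%:C ph'; rewrite -/kq; apply: le_trans.
  have -> : h' q%:C = - (c * K p%:C q%:C) by rewrite /h' /mulX subrr mul0r sub0r.
  by rewrite cmodN (cmodM c) [in leRHS]exprMn.
have Nh : N (mulX q f) <= C2 * N h'.
  rewrite hE; apply: le_trans (Lf_sqrD_le G (W_mass_ge0 G) ph' pcK) _.
  rewrite line_sqrZ LfZ; last exact: PW_integ pK.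
  rewrite -/k.
  have : cmod c ^+ 2 <= 2 * (N h' * kq) / kap ^+ 2 by rewrite ler_pdivlMr.
  move=> /(ler_wpM2r (ltW k0)) H.
  have -> : C2 * N h' = 2 * N h' + 2 * (2 * (N h' * kq) / kap ^+ 2 * k).
    by rewrite /C2; field; rewrite gt_eqF.
  lra.
have [pf _] := df.
apply: le_trans (HCq f pf ph) _; rewrite -mulrA ler_wpM2l ?(ltW Cq0)//.
apply: le_trans Nh _; rewrite -mulrA ler_wpM2l ?(ltW C20)//.
Qed.

Lemma W_int_sqr_mulX f :
  (fun x : R => cmod ((x - alpha)%:C * f x%:C) ^+ 2) = line_sqr (mulX alpha f).
Proof. by apply/funext => x; rewrite /line_sqr /mulX rmorphB. Qed.

(** A finite weighted integral would force square-integrability: the density is bounded below off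
    [-1, 1], and f is bounded on it. Hence functions outside [dom] have quotient +oo. *)
Lemma W_int_sqr_infty f : entire f -> ~ integ (line_sqr f) ->
  W_int G (line_sqr f) = +oo%E.
Proof.
move=> ef nif; rewrite /W_int.
suff -> : (\int[mu]_x (line_sqr f x * W_dens G x)%:E = +oo)%E by [].
apply/eqP; rewrite -leye_eq leNgt; apply/negP => fy; apply: nif.
have iW : integ (fun x => line_sqr f x * W_dens G x).
  apply: integ_ge0_lty => //.
    by apply: measurable_funM; [exact: line_sqr_measurable|exact: W_dens_measurable].
  by move=> x; rewrite mulr_ge0 ?line_sqr_ge0 ?W_dens_ge0.
have [c c0 Hc] := W_dens_lower G (@ltr01 R).
have l11 : -1 <= 1 :> R by lra.
have [S S0 HS] := line_sqr_bounded ef l11.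
have mf := line_sqr_measurable ef.
apply: (integ_indic_dom (S := S) (c := c^-1) (a := -1) (b := 1) mf (line_sqr_ge0 f) iW).
have ci : 0 <= c^-1 by rewrite invr_ge0 ltW.
move=> x; rewrite indicE mem_setE in_itv /= -ler_norml.
case: (lerP `|x| 1) => x1 /=.
  rewrite mulr1; move: x1; rewrite ler_norml => /HS fS.
  apply: le_trans fS _; rewrite lerDl mulr_ge0//.
  by rewrite mulr_ge0 ?line_sqr_ge0 ?W_dens_ge0.
rewrite mulr0 add0r ler_pdivlMl// mulrC ler_wpM2l ?line_sqr_ge0//.
by apply: Hc; exact: ltW.
Qed.

Lemma dom_nontrivial : exists2 f, dom f & f <> cst 0.
Proof.
have [F [pF pzF F0]] := test_function alpha tau_gt0.
by exists F => // F00; move: F0; rewrite F00 eqxx.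
Qed.

Lemma N_gt0 f : PW tau f -> f <> cst 0 -> 0 < N f.
Proof.
move=> pf fn; rewrite lt_def N_ge0 andbT; apply/eqP => N0.
by apply: fn; exact: (N_eq0 hK pf N0).
Qed.

Lemma extremal_first_zero : exists xi1 : R,
  is_first_positive_zero (fun x : R => K ((alpha + x)%:C) ((alpha - x)%:C)) xi1
  /\ extremal_A G tau alpha = (xi1 ^+ 2)%:E.
Proof.
pose S := [set N (mulX alpha f) / N f | f in [set f | dom f /\ f <> cst 0]].
have S0 : S !=set0.
  by have [f df fn] := dom_nontrivial; exists (N (mulX alpha f) / N f), f.
have lbS : lbound S 0.
  by move=> _ [f _ <-]; rewrite divr_ge0// N_ge0.
have hS : has_inf S by split => //; exists 0.
pose lam := inf S.
have lam0 : 0 <= lam by apply: lb_le_inf.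
pose xi := Num.sqrt lam.
have xi0 : 0 <= xi by exact: sqrtr_ge0.
have xiE : xi ^+ 2 = lam by rewrite sqr_sqrtr.
have Hlam f : dom f -> f <> cst 0 -> lam <= N (mulX alpha f) / N f.
  by move=> df fn; apply: ge_inf; [exact: hS.2|exists f].
have Hxi f : dom f -> xi ^+ 2 * N f <= N (mulX alpha f).
  move=> df; rewrite xiE; have [pf _] := df.
  have [->|Nn0] := eqVneq (N f) 0; first by rewrite mulr0 N_ge0.
  have Nf : 0 < N f by rewrite lt_def Nn0 N_ge0.
  rewrite -ler_pdivlMr//; apply: Hlam => // f0; move: Nn0; rewrite f0.
  rewrite (_ : line_sqr (cst 0) = fun=> 0); last first.
    by apply/funext => x; rewrite /line_sqr cmod0 expr0n.
  rewrite /Lf (_ : (fun x => _) = fun=> 0); last by apply/funext => x; rewrite mul0r.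
  by rewrite Rintegral_cst// mul0r mulr0 addr0 eqxx.
(* Otherwise coercivity raises every quotient to at least lam + 1 / C. *)
have Kxi : K (alpha + xi)%:C (alpha - xi)%:C = 0.
  apply: contrapT => Kn.
  have [C C0 HC] := coercive xi0 Hxi Kn.
  have : lam + C^-1 <= lam.
    apply: lb_le_inf => // _ [f [df fn] <-]; have [pf _] := df.
    have Nf := N_gt0 pf fn.
    rewrite ler_pdivlMr// mulrDl -lerBrDl -xiE ler_pdivrMl//; exact: HC.
  by rewrite gerDl invr_le0 leNgt C0.
(* For xi = 0 the vanishing value would be K(alpha, alpha), which is positive. *)
have xip : 0 < xi.
  rewrite lt_def xi0 andbT; apply/eqP => x0; move: Kxi.
  rewrite x0 addr0 subr0 (kernel_diag hK) => /(congr1 Re) /= H.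
  by have := kernel_diag_gt0 tau_gt0 hK alpha; rewrite H ltxx.
have quot f : PW tau f -> f <> cst 0 -> dom f ->
  (W_int G (fun x : R => cmod ((x - alpha)%:C * f x%:C) ^+ 2)%R
     / W_int G (fun x : R => cmod (f x%:C) ^+ 2)%R)%E = (N (mulX alpha f) / N f)%:E.
  move=> pf fn [_ pzf]; rewrite W_int_sqr_mulX (W_intE G (PW_integ pzf)).
  rewrite (W_intE G (PW_integ pf)) inver gt_eqF ?EFinM//.
  exact: N_gt0.
exists xi; split.
  (* A zero x below xi would make x^2 < xi^2 a value of the quotient. *)
  split => // x /andP[x0 xx] Kx.
  have [f [df fn fE]] := zero_attained Kx.
  have [pf _] := df; have Nf := N_gt0 pf fn.
  have := Hxi f df; rewrite fE ler_pM2r// ler_pXn2r ?nnegrE ?(ltW x0)//.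
  by rewrite leNgt xx.
apply/eqP; rewrite eq_le; apply/andP; split.
  have [f [df fn fE]] := zero_attained Kxi.
  have [pf _] := df; have Nf := N_gt0 pf fn.
  apply: ereal_inf_lbound; exists f => //.
  by rewrite quot// fE mulfK// gt_eqF.
apply: le_ereal_inf_tmp => _ [f [pf fn] <-].
have Nf := N_gt0 pf fn.
have [iz|niz] := pselect (integ (line_sqr (mulX alpha f))).
  have df : dom f by split => //; exact: PW_mulX.
  by rewrite quot// lee_fin xiE; exact: Hlam.
rewrite W_int_sqr_mulX W_int_sqr_infty//; last first.
  exact: (entireM (@entire_sub R alpha%:C) (PW_entire pf)).
rewrite (W_intE G (PW_integ pf)) inver gt_eqF// gt0_mulye ?leey// lte_fin invr_gt0//.
Qed.

End Extremal.

Theorem theorem2 (R : realType) (alpha Delta : R) (hDelta : 0 < Delta)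
    (G : symmetry_group) (K : R[i] -> R[i] -> R[i])
    (hK : is_reproducing_kernel G (pi * Delta) K) :
  exists xi1 : R,
    is_first_positive_zero
      (fun x : R => K ((alpha + x)%:C) ((alpha - x)%:C)) xi1
    /\ extremal_A G (pi * Delta) alpha = (xi1 ^+ 2)%:E.
Proof.
by apply: extremal_first_zero hK _; rewrite mulr_gt0// pi_gt0.
Qed.
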